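(* Let $C:f=0$ be a reduced plane curve of degree $d\geq 3$ in $\mathbb{P}^2$ with exponents $d_1\leq\dots\leq d_m$. If all the irreducible components $C_i$ of $C$ are rational, then $d_m\leq d-1$.
   Context: Let $S=\mathbb{C}[x,y,z]$ with its standard grading, $f\in S$ homogeneous of degree $d$. Put $AR(f)=\{(a,b,c)\in S^3: af_x+bf_y+cf_z=0\}$, a graded $S$-module in which $(a,b,c)$ has degree $k$ when $a,b,c\in S_k$. The exponents $d_1\leq\dots\leq d_m$ of $C$ are the degrees of the elements of a minimal set of homogeneous generators of $AR(f)$. An irreducible curve is rational if its normalization has genus $0$. *)

(* Defs.v *)
From HB Require Import structures.
From mathcomp Require Import all_boot all_order all_algebra.
From mathcomp Require Import mpoly.

Set Implicit Arguments.
Unset Strict Implicit.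
Unset Printing Implicit Defensive.

Import GRing.Theory.
Local Open Scope ring_scope.

Section PlaneCurves.
Variable F : fieldType.
Local Notation S := {mpoly F[3]}.

Definition mdvd (p q : S) : Prop := exists h : S, q = p * h.

(* This excludes f = 0, since 0 * 0 divides 0 and 0 is not a unit. *)
Definition squarefree (f : S) : Prop :=
  forall g : S, mdvd (g * g) f -> g \is a GRing.unit.

Definition mirreducible (g : S) : Prop :=
  [/\ g != 0, g \isn't a GRing.unit
    & forall a b : S, g = a * b -> a \is a GRing.unit \/ b \is a GRing.unit].

(* The plane curve g = 0, for g homogeneous, is an irreducible component of
   the plane curve f = 0.  (A factor of a nonzero homogeneous polynomial is
   automatically homogeneous.) *)
Definition component (g f : S) : Prop := mirreducible g /\ mdvd g f.

(* The elements (a, b, c) of S^3 are row vectors. *)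
Definition AR (f : S) (r : 'rV[S]_3) : Prop :=
  \sum_(j < 3) r 0 j * f^`M(j) = 0.

(* The rows of G generate AR f as an S-module. *)
Definition generates_AR (f : S) (m : nat) (G : 'M[S]_(m, 3)) : Prop :=
  forall r : 'rV[S]_3, AR f r <-> exists c : 'rV[S]_m, r = c *m G.

Definition exponents (f : S) (ds : seq nat) : Prop :=
  sorted leq ds /\
  exists G : 'M[S]_(size ds, 3),
    [/\ forall k j, G k j \is (nth 0%N ds k).-homog,
        generates_AR f G
      & forall k, ~ generates_AR f (row' k G)].

(* K is the field of rational functions of the integral plane curve g = 0, and
   [xi 0 : xi 1 : xi 2] are homogeneous coordinates of its generic point: a
   homogeneous p vanishes on the curve iff p(xi) = 0, and every element of K
   is a quotient of two forms of the same degree.  This determines K over F up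
   to a unique isomorphism, and xi up to a common factor. *)
Definition function_field (g : S) (K : fieldType) (iota : {rmorphism F -> K})
    (xi : 'I_3 -> K) : Prop :=
  (forall (k : nat) (p : S), p \is k.-homog ->
     (mmap iota xi p = 0 <-> mdvd g p)) /\
  (forall a : K, exists (k : nat) (p q : S),
     [/\ p \is k.-homog, q \is k.-homog, mmap iota xi q != 0
       & a = mmap iota xi p / mmap iota xi q]).

Definition derivation (K : fieldType) (iota : {rmorphism F -> K})
    (V : lmodType K) (D : K -> V) : Prop :=
  [/\ forall a b, D (a + b) = D a + D b,
      forall a b, D (a * b) = a *: D b + b *: D a
    & forall c : F, D (iota c) = 0].

(* (Om, d) is the module of Kaehler differentials of K over F. *)
Definition kahler (K : fieldType) (iota : {rmorphism F -> K})
    (Om : lmodType K) (d : K -> Om) : Prop :=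
  derivation iota d /\
  forall (V : lmodType K) (D : K -> V), derivation iota D ->
    exists2 phi : {linear Om -> V},
      (forall a, phi (d a) = D a)
      & forall psi : {linear Om -> V},
          (forall a, psi (d a) = D a) -> psi =1 phi.

(* Membership in the coordinate ring, inside K, of the normalization of the
   affine chart x_i != 0: the integral closure in K of F[x_j / x_i]_j. *)
Definition normal_chart (K : fieldType) (iota : {rmorphism F -> K})
    (xi : 'I_3 -> K) (i : 'I_3) (a : K) : Prop :=
  integralOver (mmap iota (fun j => xi j / xi i)) a.

(* Global sections of the sheaf of differentials on the normalization X.  X is
   glued from the Spec A_i, A_i the normalized chart ring; it is regular, so
   for F perfect the module of differentials of A_i embeds in the one of K,
   its image being the A_i-span of the d v with v in A_i.  Charts with
   xi i = 0 do not meet the curve. *)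
Definition regular_form (K : fieldType) (iota : {rmorphism F -> K})
    (xi : 'I_3 -> K) (Om : lmodType K) (d : K -> Om) (w : Om) : Prop :=
  forall i : 'I_3, xi i != 0 ->
    exists s : seq (K * K),
      (forall u, u \in s ->
         normal_chart iota xi i u.1 /\ normal_chart iota xi i u.2) /\
      w = \sum_(u <- s) u.1 *: d u.2.

(* The F-vector space of global regular differentials has dimension n. *)
Definition genus (K : fieldType) (iota : {rmorphism F -> K})
    (xi : 'I_3 -> K) (Om : lmodType K) (d : K -> Om) (n : nat) : Prop :=
  exists e : 'I_n -> Om,
    (forall k, regular_form iota xi d (e k)) /\
    (forall w, regular_form iota xi d w ->
       exists! c : {ffun 'I_n -> F}, w = \sum_(k < n) iota (c k) *: e k).

Definition normalization_genus (g : S) (n : nat) : Prop :=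
  exists (K : fieldType) (iota : {rmorphism F -> K}) (xi : 'I_3 -> K)
         (Om : lmodType K) (d : K -> Om),
    [/\ function_field g iota xi, kahler iota d & genus iota xi d n].

(* For F algebraically closed and g irreducible. *)
Definition rational_curve (g : S) : Prop := normalization_genus g 0.

End PlaneCurves.

(* Main.v *)
(* Write J for the Jacobian ideal, n = d - 1.  If h, of degree d - 3, satisfies
   x_i^N h in J for all i and some N, then the Poincare residue of h / f is a
   regular differential form on the normalization of each component of the
   curve: on the chart x_i != 0, an expression of x_i^N h in terms of the
   partial derivatives shows that it has polynomial coefficients.  All
   components being rational, it vanishes, hence f divides h and h = 0.

   On the other hand, choose a line on which f is squarefree and coordinates
   for which this line is ell = 0.  The derivatives g1, g2 of f along the line
   and ell form a regular sequence.  Let g3 be the third derivative and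
   L = (g1, g2) : g3.  Since L is the ideal of last coordinates of AR(f), and
   the kernel of AR(f) -> L is generated by (g2, -g1, 0) in degree n, it is
   enough to see that L is generated in degrees <= n, which follows from
   S_n = ell S_(n-1) + L_n.  Otherwise a linear functional on
   S / (g1, g2, ell - 1), a Frobenius algebra, kills S_(n-1) and L, but not
   S_n; Macaulay duality for the binary forms g1, g2 on the line then turns it
   into a nonzero h of degree d - 3 with ell^N h in J, which is absurd. *)

Require Import Defs.
From HB Require Import structures.
From mathcomp Require Import all_boot all_order all_algebra.
From mathcomp Require Import boolp classical_sets reals.
From mathcomp Require Import complex mpoly.
From mathcomp Require Import ring zify.

Set Implicit Arguments.
Unset Strict Implicit.
Unset Printing Implicit Defensive.

Import Order.TTheory GRing.Theory Num.Theory.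
Local Open Scope ring_scope.

(** * Homogeneous polynomials *)

Section GradedPolynomials.
Variables (n : nat) (F : fieldType).
Local Notation S := {mpoly F[n]}.
Implicit Types (p q r : S) (k l : nat).

(** The degree d - 3 arises twice. It is the one for which h / f_k times x_i dx_j - x_j dx_i has
    weight 0, since f_k has degree d - 1; and it is (2 n - 2) - n, the socle degree of two binary
    forms of degree n minus the degree of g3. A functional on S / (g1, g2, ell - 1) is filtered, not
    graded: its part in the lowest degree where it does not vanish is a functional on binary forms,
    so duality on the line, reduced to univariate polynomials, is lifted one degree at a time.
    Powers of ell restore homogeneity and can be cancelled because ell is a nonzerodivisor modulo
    (g1, g2).

    The same cancellation gives the generation of L. Multiplying by the variables, S_k = ell S_(k-1)
    + L_k for all k >= n. If c = sum x_i f_i of degree above n is in L and f_i = ell q_i modulo L,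
    then ell (sum x_i q_i) is in L, hence so is Q = sum x_i q_i, and ell Q is redistributed by
    writing ell as a combination of the x_i. *)

Lemma mpoly_ring_ind (P : S -> Prop) :
  (forall c, P c%:MP) -> (forall i, P 'X_i) ->
  (forall p q, P p -> P q -> P (p + q)) ->
  (forall p q, P p -> P q -> P (p * q)) -> forall p, P p.
Proof.
move=> PC PX PD PM; elim/mpolyind => [|c m p _ _ Pp]; first by rewrite -mpolyC0.
apply: (PD) => //; rewrite -mul_mpolyC; apply: (PM) => //.
rewrite mpolyXE_id; elim/big_rec: _ => [|i q _ Pq]; first by rewrite -mpolyC1.
apply: (PM) => //; elim: (m i) => [|k IH]; first by rewrite expr0 -mpolyC1.
by rewrite exprS; apply: (PM).
Qed.

Lemma dhomog_ind (P : nat -> S -> Prop) :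
  (forall k, P k 0) -> (forall c, P 0%N c%:MP) -> (forall i, P 1%N 'X_i) ->
  (forall k p q, P k p -> P k q -> P k (p + q)) ->
  (forall k l p q, P k p -> P l q -> P (k + l)%N (p * q)) ->
  forall k p, p \is k.-homog -> P k p.
Proof.
move=> P0 PC PX PD PM k p /dhomogP hp; rewrite (mpolyE p) big_seq.
elim/big_rec: _ => [|m q mp Pq]; first exact: P0.
apply: (PD) => //; rewrite -mul_mpolyC -[k]add0n; apply: (PM) => //.
rewrite -(hp m mp) /= mdegE mpolyXE_id.
apply: (big_ind2 P) => [||i _].
- by rewrite -mpolyC1.
- by move=> k1 q1 k2 q2; apply: (PM).
elim: (m i) => [|j IH]; first by rewrite expr0 -mpolyC1.
by rewrite exprS -add1n; apply: (PM).
Qed.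

Lemma dhomogC c : (c%:MP : S) \is 0.-homog.
Proof. by rewrite -[c%:MP]mulr1 mul_mpolyC dhomogZ ?dhomog1. Qed.

Lemma dhomogXi i : ('X_i : S) \is 1.-homog.
Proof. by rewrite dhomogX /= mdeg1. Qed.

Lemma dhomogB k p q : p \is k.-homog -> q \is k.-homog -> p - q \is k.-homog.
Proof. by move=> hp hq; rewrite rpredB. Qed.

(* The grading is encoded by the ring morphism x_i |-> x_i t. *)
Definition scaling : {rmorphism S -> {poly S}} :=
  mmap (@polyC S \o @mpolyC n F) (fun i => ('X_i)%:P * 'X).

Arguments scaling : simpl never.

Lemma scaling_homog k p : p \is k.-homog -> scaling p = p%:P * 'X^k.
Proof.
move=> hp; move: k p hp; apply: dhomog_ind => [k|c|i|k p q Hp Hq|k l p q Hp Hq].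
- by rewrite rmorph0 polyC0 mul0r.
- by rewrite /scaling /= mmapC expr0 mulr1.
- by rewrite /scaling /= mmapX mmap1U expr1.
- by rewrite rmorphD /= Hp Hq polyCD mulrDl.
- by rewrite rmorphM /= Hp Hq polyCM exprD mulrACA.
Qed.

Lemma pihomog_sum p : p = \sum_(k < msize p) pihomog mdeg k p.
Proof. by apply: pihomog_partitionE; rewrite leqnn. Qed.

Lemma coef_scaling p k : (scaling p)`_k = pihomog mdeg k p.
Proof.
rewrite {1}[p]pihomog_sum rmorph_sum coef_sum /=.
rewrite [p in RHS]pihomog_sum linear_sum /=.
apply: eq_bigr => i _; have hi := pihomogP [measure of mdeg] i p.
rewrite (scaling_homog hi) coefCM coefXn; case: eqP => [->|/eqP ki].
  by rewrite mulr1 pihomog_id.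
by rewrite mulr0 (pihomog_ne0 _ hi) // eq_sym.
Qed.

Lemma pihomogM k p q j : p \is k.-homog ->
  pihomog mdeg j (p * q) = if (j < k)%N then 0 else p * pihomog mdeg (j - k) q.
Proof.
move=> hp; rewrite -coef_scaling rmorphM /= (scaling_homog hp) -mulrA coefCM.
by rewrite coefXnM; case: ifP; rewrite ?mulr0 // coef_scaling.
Qed.

End GradedPolynomials.

(** ['X] is prime over a domain, so one factor ['X] can be cancelled at each step. Through
    [scaling], this makes the factors of a nonzero form homogeneous. *)
Lemma mul_eq_polyXn (A : idomainType) (u v : {poly A}) c d :
  c != 0 -> u * v = c%:P * 'X^d -> exists k a, u = a%:P * 'X^k.
Proof.
move=> c0; elim: d u v => [|d IH] u v.
  rewrite expr0 mulr1 => uv; exists 0%N, u`_0; rewrite expr0 mulr1.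
  have: size (u * v) = 1%N by rewrite uv size_polyC c0.
  have [->|u0] := eqVneq u 0; first by rewrite coef0.
  have [->|v0] := eqVneq v 0; first by rewrite mulr0 size_poly0.
  rewrite size_mul // => s1; apply: size1_polyC.
  by move: s1; rewrite -size_poly_gt0 in v0; lia.
move=> uv; have: (u * v)`_0 = 0 by rewrite uv exprSr mulrA coefMX.
rewrite coef0M => /eqP; rewrite mulf_eq0 -!horner_coef0 => /orP[] /factor_theorem[w wE].
  rewrite polyC0 subr0 in wE; have /IH[k [a wa]] : w * v = c%:P * 'X^d.
    apply: (mulIf (negbT (polyX_eq0 A))).
    by rewrite -[RHS]mulrA -exprSr -uv wE; ring.
  by exists k.+1, a; rewrite wE wa exprSr mulrA.
rewrite polyC0 subr0 in wE; apply: (IH u w).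
apply: (mulIf (negbT (polyX_eq0 A))).
by rewrite -[RHS]mulrA -exprSr -uv wE; ring.
Qed.

(** * Divisibility among forms *)

Section Divisibility.
Variables (F : numFieldType).
Local Notation S := {mpoly F[3]}.
Implicit Types (p q r f g h : S) (k l : nat).

Lemma mdvd_trans p q r : mdvd p q -> mdvd q r -> mdvd p r.
Proof. by case=> u -> [v ->]; exists (u * v); rewrite mulrA. Qed.

Lemma mdvd_mulr p q r : mdvd p q -> mdvd p (q * r).
Proof. by case=> u ->; exists (u * r); rewrite mulrA. Qed.

Lemma mdvd_mull p q r : mdvd p q -> mdvd p (r * q).
Proof. by rewrite mulrC; apply: mdvd_mulr. Qed.

Lemma mdvdD p q r : mdvd p q -> mdvd p r -> mdvd p (q + r).
Proof. by case=> u -> [v ->]; exists (u + v); rewrite mulrDr. Qed.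

Lemma mdvdN p q : mdvd p q -> mdvd p (- q).
Proof. by case=> u ->; exists (- u); rewrite mulrN. Qed.

Lemma mdvd0 p : mdvd p 0. Proof. by exists 0; rewrite mulr0. Qed.

Lemma mpoly_unitE p : (p \is a GRing.unit) = (msize p == 1%N).
Proof.
apply/idP/idP => [|/eqP p1].
  by case/andP => /eqP pE; rewrite unitfE => u; rewrite pE msizeC u.
have pE := msize1_polyC (eq_leq p1); apply/andP; split; first exact/eqP.
by rewrite unitfE; apply: contra_eq_neq p1 => p0; rewrite pE p0 msize0.
Qed.

Lemma factor_homog d p q : p * q != 0 -> p * q \is d.-homog ->
  exists2 k, p \is k.-homog & (k <= d)%N.
Proof.
move=> pq0 hpq; have := scaling_homog hpq; rewrite rmorphM.
case/(mul_eq_polyXn pq0) => k [a Ea].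
have p0 : p != 0 by apply: contra_neq pq0 => ->; rewrite mul0r.
have hp : p \is k.-homog.
  rewrite [p]pihomog_sum; apply: rpred_sum => i _.
  have [<-|ik] := eqVneq (i : nat) k; first exact: pihomogP.
  by rewrite -coef_scaling Ea coefCM coefXn (negPf ik) mulr0 rpred0.
exists k => //; rewrite leqNgt; apply: contraNN pq0 => dk.
by rewrite -(pihomog_dE hpq) (pihomogM _ _ hp) dk.
Qed.

Lemma mdvd_homog d p q : q != 0 -> q \is d.-homog -> mdvd p q ->
  exists2 k, p \is k.-homog & (k <= d)%N.
Proof. by move=> q0 hq [h E]; rewrite E in q0 hq; apply: factor_homog q0 hq. Qed.

Lemma mdvd_homogE k d p q : p \is k.-homog -> q \is d.-homog -> mdvd p q ->
  exists2 h, h \is (d - k).-homog & q = p * h.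
Proof.
move=> hp hq [h E]; have := pihomogM h d hp; rewrite -E pihomog_dE // => qE.
(* If [d < k], then [q] is 0, and the cofactor 0 is homogeneous of the truncated degree [d - k]
   too. *)
exists (if (d < k)%N then 0 else pihomog mdeg (d - k) h).
  by case: ifP; rewrite ?rpred0 ?pihomogP.
by rewrite qE; case: ifP; rewrite ?mulr0.
Qed.

Lemma mdvd_lt_deg k l p q : p \is k.-homog -> q \is l.-homog -> (l < k)%N ->
  mdvd p q -> q = 0.
Proof.
move=> hp hq lk [h E]; have := pihomogM h l hp.
by rewrite -E pihomog_dE // lk.
Qed.

Lemma mdvd_pihomog k j p q : p \is k.-homog -> mdvd p q ->
  mdvd p (pihomog mdeg j q).
Proof.
by move=> hp [h ->]; rewrite (pihomogM _ _ hp); case: ifP => _;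
  [apply: mdvd0 | exists (pihomog mdeg (j - k) h)].
Qed.

Lemma mdvd_of_pihomog p q : (forall j, mdvd p (pihomog mdeg j q)) -> mdvd p q.
Proof.
move=> H; rewrite [q]pihomog_sum; elim/big_rec: _ => [|i r _]; first exact: mdvd0.
exact: mdvdD.
Qed.

Lemma squarefree_neq0 f : squarefree f -> f != 0.
Proof.
move=> sf; apply/eqP => f0.
have /sf : mdvd (0 * 0) f by exists 0; rewrite f0 mulr0.
by rewrite unitr0.
Qed.

Lemma irreducible_factor p : p != 0 -> p \isn't a GRing.unit ->
  exists2 g, mirreducible g & mdvd g p.
Proof.
have [m] := ubnP (msize p); elim: m p => // m IH p pm p0 up.
have [irr|nirr] := pselect (mirreducible p).
  by exists p => //; exists 1; rewrite mulr1.
have [a [b [pE ua ub]]] :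
    exists a b, [/\ p = a * b, a \isn't a GRing.unit & b \isn't a GRing.unit].
  apply: contrapT => H; apply: nirr; split => // a b pE.
  have [|ua] := boolP (a \is a GRing.unit); first by left.
  have [|ub] := boolP (b \is a GRing.unit); first by right.
  by case: H; exists a, b.
have a0 : a != 0 by apply: contra_neq p0 => a0; rewrite pE a0 mul0r.
have b0 : b != 0 by apply: contra_neq p0 => b0; rewrite pE b0 mulr0.
have /IH[//|//|g ig ga] : (msize a < m)%N.
  move: pm ub (b0); rewrite pE msizeM // mpoly_unitE -msize_poly_eq0.
  by move: (msize a) (msize b) => *; lia.
by exists g => //; rewrite pE; apply: mdvd_mulr.
Qed.

(* The function field of a component shows it to be prime for forms; with this,
   unique factorization in S is not needed. *)
Definition hprime g := forall k l p q, p \is k.-homog -> q \is l.-homog ->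
  mdvd g (p * q) -> mdvd g p \/ mdvd g q.

(** Divide [f] and [h] by one component [g] and recurse. A component [g'] of the cofactor [f'] does
    not divide [g], since [g' * g'] would then divide [f]; so primality of [g'] moves its
    divisibility from [h] to [h']. *)
Lemma squarefree_mdvd d k f h : f \is d.-homog -> squarefree f ->
  (forall g, component g f -> hprime g) -> h \is k.-homog ->
  (forall g, component g f -> mdvd g h) -> mdvd f h.
Proof.
have [m] := ubnP (msize f); elim: m d k f h => // m IH d k f h fm hf sf pr hh gh.
have f0 := squarefree_neq0 sf.
have [uf|nuf] := boolP (f \is a GRing.unit).
  by exists (f^-1 * h); rewrite mulrA divrr // mul1r.
have [g ig gf] := irreducible_factor f0 nuf.
have [e hg le] := mdvd_homog f0 hf gf.
have [f' hf' fE] := mdvd_homogE hg hf gf.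
have [h' hh' hE] := mdvd_homogE hg hh (gh _ (conj ig gf)).
have [g0 ng _] := ig.
have f'0 : f' != 0 by apply: contra_neq f0 => f'0; rewrite fE f'0 mulr0.
have cf' g' : component g' f' -> component g' f.
  by case=> ig' gf'; split=> //; rewrite fE; apply: mdvd_mull.
have sf' : squarefree f'.
  by move=> u uf'; apply: sf; rewrite fE; apply: mdvd_mull.
suff: mdvd f' h' by case=> u hE'; exists u; rewrite hE hE' fE mulrA.
apply: (IH (d - e)%N (k - e)%N) => //.
- move: fm ng (g0); rewrite fE msizeM // mpoly_unitE -msize_poly_eq0.
  by move: (msize g) (msize f') => *; lia.
- by move=> g' /cf'; apply: pr.
move=> g' cg'; have := gh _ (cf' _ cg'); rewrite hE.
case/(pr _ (cf' _ cg') _ _ _ _ hg hh') => // - [v gE].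
have [[g'0 ng' _] [w fw]] := cg'; have [_ _ /(_ _ _ gE)[u|uv]] := ig.
  by rewrite u in ng'.
case/negP: ng'; apply: sf.
by exists (v * w); rewrite fE gE fw; ring.
Qed.

End Divisibility.

(** * Directional derivatives and restriction to a line *)

Section Derivatives.
Variables (n : nat) (F : numFieldType).
Local Notation S := {mpoly F[n]}.
Implicit Types (p q : S) (P : 'I_n -> F).

Lemma mderiv_homog i k p : p \is k.-homog -> p^`M(i) \is (k.-1).-homog.
Proof.
move=> /dhomogP hp; apply/dhomogP => m; rewrite mcoeff_msupp mcoeff_deriv => H.
have /hp : (m + U_(i))%MM \in msupp p.
  by rewrite mcoeff_msupp; apply: contra_neq H => ->; rewrite mul0rn.
by rewrite /= mdegD mdeg1 addn1 => <-.
Qed.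

Lemma mderivXi i j : ('X_j : S)^`M(i) = (j == i)%:R.
Proof.
rewrite mderivX mnm1E; case: eqP => [->|_]; last by rewrite scale0r.
by rewrite scale1r -{1}[U_(i)%MM]add0m addmK mpolyX0.
Qed.

Lemma euler k p : p \is k.-homog -> \sum_i 'X_i * p^`M(i) = k%:R *: p.
Proof.
move=> hp; move: k p hp; apply: dhomog_ind => [k|c|i|k p q Hp Hq|k l p q Hp Hq].
- by rewrite scaler0 big1 // => i _; rewrite mderiv0 mulr0.
- by rewrite scale0r big1 // => i _; rewrite mderivC mulr0.
- rewrite scale1r (bigD1 i) //= mderivXi eqxx mulr1 big1 ?addr0 // => j ji.
  by rewrite mderivXi eq_sym (negPf ji) mulr0.
- rewrite scalerDr -Hp -Hq -big_split; apply: eq_bigr => i _.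
  by rewrite mderivD mulrDr.
rewrite natrD scalerDl scalerAl -Hp [X in _ + X]scalerAr -Hq mulr_suml mulr_sumr -big_split.
by apply: eq_bigr => i _; rewrite mderivM /=; ring.
Qed.

Lemma euler_split k p : p \is (k.+1).-homog ->
  exists2 f : 'I_n -> S, (forall i, f i \is k.-homog) & p = \sum_i 'X_i * f i.
Proof.
move=> hp; exists (fun i => (k.+1%:R : F)^-1 *: p^`M(i)) => [i|].
  by apply/dhomogZ/(mderiv_homog i hp).
have pE : p = (k.+1%:R : F)^-1 *: (k.+1%:R *: p).
  by rewrite scalerA mulVf ?scale1r ?pnatr_eq0.
rewrite [LHS]pE -(euler hp) scaler_sumr; apply: eq_bigr => i _.
exact: scalerAr.
Qed.

Definition dird P p : S := \sum_i P i *: p^`M(i).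

Lemma dird_homog P k p : p \is k.-homog -> dird P p \is (k.-1).-homog.
Proof. by move=> hp; apply: rpred_sum => i _; apply/dhomogZ/mderiv_homog. Qed.

Lemma dirdC P c : dird P c%:MP = 0.
Proof. by rewrite /dird big1 // => i _; rewrite mderivC scaler0. Qed.

Lemma dirdX P i : dird P 'X_i = (P i)%:MP.
Proof.
rewrite /dird (bigD1 i) //= mderivXi eqxx big1 ?addr0 => [|j ji].
  by rewrite -mul_mpolyC mulr1.
by rewrite mderivXi eq_sym (negPf ji) scaler0.
Qed.

Lemma dirdD P p q : dird P (p + q) = dird P p + dird P q.
Proof.
by rewrite /dird -big_split; apply: eq_bigr => i _; rewrite mderivD scalerDr.
Qed.

Lemma dirdM P p q : dird P (p * q) = dird P p * q + p * dird P q.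
Proof.
rewrite /dird mulr_suml mulr_sumr -big_split; apply: eq_bigr => i _ /=.
by rewrite mderivM scalerDr scalerAl scalerAr.
Qed.

Lemma dird_meval P k p : p \is k.-homog -> (dird P p).@[P] = k%:R * p.@[P].
Proof.
move=> hp; rewrite -mevalZ -(euler hp) /dird !rmorph_sum /=.
by apply: eq_bigr => i _; rewrite mevalZ mevalM mevalXU.
Qed.

Section Line.
Variables (A : comNzRingType) (u : {rmorphism F -> A}).
Variables (Q : 'I_n -> A) (P : 'I_n -> F).

(* [line] is kept opaque: unfolding it makes unification explode. *)
Lemma line_subproof : {r : {rmorphism S -> {poly A}} |
  (forall c, r c%:MP = (u c)%:P) /\
  (forall i, r 'X_i = (Q i)%:P + (u (P i))%:P * 'X)}.
Proof.
exists (mmap (@polyC A \o u) (fun i => (Q i)%:P + (u (P i))%:P * 'X)).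
by split=> [c|i]; rewrite /= ?mmapC // mmapX mmap1U.
Qed.

(** The values lie over any ring [A] above [F]: with [A] the field, [Q] is a point; with [A] the
    polynomial ring, [Q] can be the generic point. *)
Definition line := sval line_subproof.

Lemma lineC c : line c%:MP = (u c)%:P.
Proof. exact: (proj1 (svalP line_subproof)). Qed.

Lemma lineX i : line 'X_i = (Q i)%:P + (u (P i))%:P * 'X.
Proof. exact: (proj2 (svalP line_subproof)). Qed.

Lemma line_dird p : (line p)^`() = line (dird P p).
Proof.
elim/mpoly_ring_ind: p => [c|i|p q Hp Hq|p q Hp Hq].
- by rewrite lineC derivC dirdC rmorph0.
- by rewrite lineX dirdX lineC derivD derivC add0r derivM derivC mul0r add0r derivX mulr1.
- by rewrite dirdD !rmorphD derivD Hp Hq.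
- by rewrite dirdM rmorphD !rmorphM derivM Hp Hq.
Qed.

(** [P] is the point at infinity of the line, so the coefficient of degree [k] is the value
    there. *)
Lemma line_homog k p : p \is k.-homog ->
  (size (line p) <= k.+1)%N /\ (line p)`_k = u p.@[P].
Proof.
move=> hp; move: k p hp; apply: dhomog_ind => [k|c|i|k p q [Sp Cp] [Sq Cq]|k l p q [Sp Cp] [Sq Cq]].
- by rewrite rmorph0 size_poly0 coef0 meval0 rmorph0.
- by rewrite lineC size_polyC coefC mevalC; case: eqP.
- rewrite lineX mevalXU coefD coefC coefCM coefX mulr1 add0r; split => //.
  rewrite (leq_trans (size_polyD _ _)) // geq_max size_polyC.
  case: eqP => _ /=; rewrite mul_polyC (leq_trans (size_scale_leq _ _)) //;
  by rewrite size_polyX.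
- rewrite !rmorphD /= coefD Cp Cq; split => //.
  by rewrite (leq_trans (size_polyD _ _)) // geq_max Sp.
rewrite !rmorphM /= -Cp -Cq; split.
  apply: leq_trans (size_polyMleq _ _) _.
  by move: (size (line p)) (size (line q)) Sp Sq => a b; lia.
rewrite coefM (bigD1 (inord k)) //= inordK ?ltnS ?leq_addr //.
rewrite addKn big1 ?addr0 // => i; rewrite -val_eqE /= inordK ?ltnS ?leq_addr //.
rewrite neq_ltn => /orP[ik|ki].
  by rewrite [(line q)`_ _]nth_default ?mulr0 // (leq_trans Sq) //; lia.
by rewrite [(line p)`_ _]nth_default ?mul0r // (leq_trans Sp).
Qed.

End Line.

Lemma line_horner Q P t p :
  (line idfun Q P p).[t] = p.@[fun i => Q i + P i * t].
Proof.
elim/mpoly_ring_ind: p => [c|i|p q Hp Hq|p q Hp Hq].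
- by rewrite lineC mevalC hornerC.
- by rewrite lineX mevalXU hornerD hornerM !hornerC hornerX.
- by rewrite !rmorphD hornerD Hp Hq.
- by rewrite !rmorphM hornerM Hp Hq.
Qed.

Lemma poly_eq0_horner (a : {poly F}) : (forall t, a.[t] = 0) -> a = 0.
Proof.
move=> H; apply/eqP/negPn/negP => a0.
have := max_poly_roots (rs := [seq i%:R | i <- iota 0 (size a)]) a0.
rewrite size_map size_iota ltnn => H'; apply/notF/H'.
  by apply/allP => x _; rewrite rootE H.
by rewrite map_inj_uniq ?iota_uniq // => i j /eqP; rewrite eqr_nat => /eqP.
Qed.

Lemma meval_eq0_mderiv p i : (forall v, p.@[v] = 0) ->
  forall v, (p^`M(i)).@[v] = 0.
Proof.
move=> H v; pose e j : F := (j == i)%:R.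
have -> : p^`M(i) = dird e p.
  rewrite /dird (bigD1 i) //= /e eqxx scale1r big1 ?addr0 // => j /negPf ->.
  by rewrite scale0r.
have r0 : line idfun v e p = 0.
  by apply: poly_eq0_horner => t; rewrite line_horner H.
have := line_horner v e 0 (dird e p); rewrite -line_dird r0 derivC horner0 => E.
rewrite [RHS]E.
by apply: meval_eq => j; rewrite mulr0 addr0.
Qed.

(** Induction on the degree: the partial derivatives of a polynomial vanishing everywhere vanish
    everywhere too, hence are 0, and in characteristic 0 only the constant term, its value at 0, is
    left. *)
Lemma meval_neq0 p : p != 0 -> exists v, p.@[v] != 0.
Proof.
apply: contra_neqP => H.
have {H} H v : p.@[v] = 0 by apply: contrapT => /eqP pv; apply: H; exists v.
have : forall m, (msize p <= mdeg m)%N -> p@_m = 0.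
  move=> m pm; apply: memN_msupp_eq0; move: pm; rewrite leqNgt.
  by apply: contra; apply: msize_mdeg_lt.
move: (msize p) => k; elim: k p H => [|k IH] p H pk; apply/mpolyP => m.
  by rewrite mcoeff0 pk.
have D i : p^`M(i) = 0.
  apply: IH => [|m' km]; first exact: meval_eq0_mderiv.
  by rewrite mcoeff_deriv pk ?mul0rn // mdegD mdeg1 addn1.
have nz m' : m' != 0%MM -> p@_m' = 0.
  move=> m'0; have [i mi] : exists i, (0 < m' i)%N.
    apply: contrapT => H'; move/eqP: m'0; apply; apply/mnmP => i; rewrite mnm0E.
    by apply/eqP; rewrite -leqn0 leqNgt; apply/negP => mi; apply: H'; exists i.
  have Um : (U_(i) <= m')%MM by rewrite lep1mP -lt0n.
  have := mcoeff_deriv i (m' - U_(i))%MM p; rewrite D mcoeff0 submK // => /esym/eqP.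
  by rewrite mulrn_eq0 => /eqP.
have pE : p = (p@_0)%:MP.
  apply/mpolyP => m'; rewrite mcoeffC.
  have [->|m'0] := eqVneq m' 0%MM; first by rewrite mulr1.
  by rewrite nz // mulr0.
by have := H (fun=> 0); rewrite pE mevalC => ->; rewrite mpolyC0.
Qed.

End Derivatives.

(** * Macaulay duality for two coprime binary forms *)

Section BinaryDuality.
Variables (F : fieldType) (n : nat) (a b c : {poly F}).
Hypotheses (n_gt0 : (0 < n)%N) (size_a : size a = n.+1).
Hypotheses (size_b : (size b <= n.+1)%N) (bcK : a %| b * c - 1).
Implicit Types (p q r e : {poly F}) (chi : {linear {poly F} -> F^o}).

(** Up to a nonzero scalar, the sum of the residues of [p / a]: a functional that makes F[X] / (a) a
    Frobenius algebra. *)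
Definition topc p : F := (p %% a)`_n.-1.

Let a0 : a != 0. Proof. by rewrite -size_poly_gt0 size_a. Qed.

Lemma topcD p q : topc (p + q) = topc p + topc q.
Proof. by rewrite /topc modpD coefD. Qed.

Lemma topcZ x p : topc (x *: p) = x * topc p.
Proof. by rewrite /topc modpZl coefZ. Qed.

Lemma topc_eqmod p q : a %| p - q -> topc p = topc q.
Proof.
by move=> apq; rewrite /topc -[p](subrK q) modpD (modp_eq0 apq) add0r.
Qed.

Lemma topc_sum (I : Type) (s : seq I) (f : I -> {poly F}) :
  topc (\sum_(i <- s) f i) = \sum_(i <- s) topc (f i).
Proof.
apply: (big_morph topc topcD); by rewrite /topc mod0p coef0.
Qed.

Lemma size_mod_a p : (size (p %% a)%R <= n)%N.
Proof. by rewrite -ltnS -size_a ltn_modp. Qed.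

(** If [r] were larger, multiplying it by a power of ['X] up to degree n - 1 would give a polynomial
    already reduced modulo [a], whose [topc] is the leading coefficient of [r]. *)
Lemma topc_nondeg r m : (size r <= n)%N ->
  (forall q, (size q <= m)%N -> topc (r * q) = 0) -> (size r <= n - m)%N.
Proof.
move=> rn H; rewrite leqNgt; apply/negP => lt_r.
have r0 : r != 0 by rewrite -size_poly_gt0; lia.
have sX : size (r * 'X^(n - size r)) = n.
  by rewrite size_mulXn // subnK.
have := H 'X^(n - size r); rewrite size_polyXn => /(_ ltac:(lia)).
rewrite /topc modp_small ?sX ?size_a // => /eqP.
rewrite -[in _.-1]sX -lead_coefE lead_coefM lead_coefXn mulr1.
by rewrite lead_coef_eq0 (negPf r0).
Qed.

(** By [topc_nondeg], the Gram matrix of the pairing [topc (p * q)] on polynomials of degree below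
    [n] is invertible. *)
Lemma topc_riesz chi : exists2 r : {poly F}, (size r <= n)%N &
  forall p, (size p <= n)%N -> chi p = topc (r * p).
Proof.
pose M := \matrix_(i < n, j < n) topc 'X^(i + j).
have expand p : (size p <= n)%N -> p = \sum_(i < n) p`_i *: 'X^i.
  move=> pn; rewrite -(poly_def n (fun i => p`_i)); apply/polyP => i.
  by rewrite coef_poly; case: ltnP => // ni; rewrite nth_default // (leq_trans pn).
have topcE (v : 'rV[F]_n) p : (size p <= n)%N ->
    topc (rVpoly v * p) = \sum_(j < n) (v *m M) 0 j * p`_j.
  move=> pn; rewrite {1}(expand _ pn) mulr_sumr topc_sum; apply: eq_bigr => j _.
  rewrite -scalerAr topcZ mulrC; congr (_ * _).
  rewrite {1}(expand (rVpoly v) (size_poly _ _)) mulr_suml topc_sum mxE; apply: eq_bigr => i _.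
  by rewrite coef_rVpoly_ord mxE -scalerAl topcZ -exprD.
have Mu : M \in unitmx.
  rewrite -row_free_unit; apply: inj_row_free => v vM.
  have r0 : rVpoly v = 0.
    apply/eqP; rewrite -size_poly_leq0 -(subnn n); apply: topc_nondeg.
      exact: size_poly.
    by move=> q qn; rewrite topcE // vM big1 // => j _; rewrite mxE mul0r.
  by rewrite -[v]rVpolyK r0 linear0.
exists (rVpoly ((\row_j chi 'X^j) *m invmx M)); first exact: size_poly.
move=> p pn; rewrite topcE // mulmxKV //.
rewrite [p in LHS](expand _ pn) linear_sum; apply: eq_bigr => j _.
by rewrite linearZ /= mxE mulrC.
Qed.

(* For a and b the dehomogenizations of two coprime forms of degree n, [socle]
   kills both ideals and induces the perfect pairing between degrees adding up
   to the socle degree 2 n - 2 of the quotient. *)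
Definition socle p : F := topc (p * c).

Lemma socleD p q : socle (p + q) = socle p + socle q.
Proof. by rewrite /socle mulrDl topcD. Qed.

Lemma socleZ x p : socle (x *: p) = x * socle p.
Proof. by rewrite /socle -scalerAl topcZ. Qed.

Lemma socle_a q : socle (a * q) = 0.
Proof. by rewrite /socle (@topc_eqmod _ 0) ?/topc ?mod0p ?coef0 // subr0 -mulrA dvdp_mulIl. Qed.

Lemma socle_b q : socle (b * q) = topc q.
Proof.
apply: topc_eqmod; have -> : b * q * c - q = (b * c - 1) * q by ring.
exact: dvdp_mulr.
Qed.

Lemma socle_neq0 : exists2 p : {poly F}, (size p <= (n + n).-1)%N & socle p != 0.
Proof.
(* [socle (b * q)] is [topc q], which is 1 at ['X^(n.-1)]; reducing modulo [a] keeps the socle and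
   bounds the size. *)
exists ((b * 'X^(n.-1)) %% a); first by apply: leq_trans (size_mod_a _) _; lia.
have -> : socle ((b * 'X^(n.-1)) %% a) = socle (b * 'X^(n.-1)).
  rewrite [in RHS](divp_eq (b * 'X^(n.-1)) a) socleD.
  by rewrite [_ * a]mulrC socle_a add0r.
rewrite socle_b /topc modp_small ?size_polyXn ?size_a ?prednK //.
by rewrite coefXn eqxx oner_eq0.
Qed.

(** Since [chi] kills multiples of [a], its representation by [topc (r * _)] extends up to degree
    [M]. As [b * c] is 1 modulo [a], the socle represents it by [r * b] modulo [a], whose degree is
    bounded by [topc_nondeg] because [chi] kills multiples of [b]. *)
Lemma socle_perfect chi K M : (K + M = (n + n).-2)%N ->
  (forall q, (size q <= M.+1 - n)%N -> chi (a * q) = 0) ->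
  (forall q, (size q <= M.+1 - n)%N -> chi (b * q) = 0) ->
  exists2 h : {poly F}, (size h <= K.+1)%N &
    forall p, (size p <= M.+1)%N -> chi p = socle (h * p).
Proof.
move=> KM chia chib; have [r rn rE] := topc_riesz chi.
have rE' p : (size p <= M.+1)%N -> chi p = topc (r * p).
  move=> pM; rewrite {1}(divp_eq p a) linearD /= [_ * a]mulrC chia ?add0r.
    rewrite rE ?size_mod_a //; apply: topc_eqmod.
    rewrite -mulrBr dvdp_mull // -dvdpNr opprB [X in X - _](divp_eq p a) addrK.
    exact: dvdp_mulIr.
  by rewrite size_divp // size_a leq_sub2r.
have hE p : socle ((r * b) %% a * p) = topc (r * p).
  apply: topc_eqmod.
  have -> : (r * b) %% a * p * c - r * p =
      (b * c - 1) * (r * p) - (r * b - (r * b) %% a) * (p * c) by ring.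
  rewrite dvdp_sub //; first exact: dvdp_mulr.
  by rewrite dvdp_mulr // {1}(divp_eq (r * b) a) addrK dvdp_mulIr.
exists ((r * b) %% a) => [|p pM]; last by rewrite hE rE'.
apply: leq_trans (@topc_nondeg _ (M.+1 - n) (size_mod_a _) _) _; last by lia.
move=> q qM.
have [q0|q0] := eqVneq q 0; first by rewrite q0 mulr0 /topc mod0p coef0.
rewrite -(chib q qM) rE'; last first.
  apply: leq_trans (size_polyMleq _ _) _; move: q0; rewrite -size_poly_gt0.
  by move: (size b) (size q) size_b qM => *; lia.
apply: topc_eqmod; rewrite mulrA -mulrBl dvdp_mulr //.
rewrite -dvdpNr opprB {1}(divp_eq (r * b) a) addrK; exact: dvdp_mulIr.
Qed.

(** The cofactor of [b] has to be [e * c] modulo [a]; the vanishing of the socle bounds its degree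
    through [topc_nondeg]. *)
Lemma socle_nondeg e j : (size e <= j.+1)%N ->
  (forall q, (j + size q <= (n + n).-1)%N -> socle (e * q) = 0) ->
  exists u v : {poly F}, [/\ e = a * u + b * v, (size u <= j.+1 - n)%N & (size v <= j.+1 - n)%N].
Proof.
move=> ej H; pose r := (e * c) %% a.
have ecE : a %| e * c - r by rewrite {1}(divp_eq (e * c) a) addrK dvdp_mulIr.
have sr : (size r <= j.+1 - n)%N.
  apply: leq_trans (@topc_nondeg _ ((n + n).-1 - j) (size_mod_a _) _) _; last by lia.
  move=> q qj; rewrite -/r.
  have [->|q0] := eqVneq q 0; first by rewrite mulr0 /topc mod0p coef0.
  rewrite -(H q).
    apply: topc_eqmod; rewrite -dvdpNr opprB.
    have -> : e * q * c - r * q = (e * c - r) * q by ring.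
    exact: dvdp_mulr.
  by move: q0; rewrite -size_poly_gt0; lia.
have : a %| e - b * r.
  have -> : e - b * r = b * (e * c - r) - (b * c - 1) * e by ring.
  by rewrite dvdp_sub //; [apply: dvdp_mull | apply: dvdp_mulr].
case/dvdpP => u uE; exists u, r; split => //; first by rewrite mulrC -uE subrK.
have [->|u0] := eqVneq u 0; first by rewrite size_poly0.
have : (size (u * a)%R <= j.+1)%N.
  rewrite -uE (leq_trans (size_polyD _ _)) // size_polyN geq_max ej /=.
  have [->|r0] := eqVneq r 0; first by rewrite mulr0 size_poly0.
  apply: leq_trans (size_polyMleq _ _) _; move: r0; rewrite -size_poly_gt0.
  by move: (size b) (size r) size_b sr => *; lia.
rewrite size_mul // size_a addnS /= => H'.
by rewrite -(leq_add2r n) subnK; move: (size u) H' => *; lia.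
Qed.

End BinaryDuality.

(** * Linkage *)

Definition lin_form (F : fieldType) (V : lmodType F) (psi : V -> F) :=
  forall x p q, psi (x *: p + q) = x * psi p + psi q.

Section LinForm.
Variables (F : fieldType) (V : lmodType F) (psi : V -> F).
Hypothesis psiL : lin_form psi.

Lemma lin_form0 : psi 0 = 0.
Proof. by have := psiL (-1) 0 0; rewrite scaler0 addr0 mulN1r addNr. Qed.

Lemma lin_formD p q : psi (p + q) = psi p + psi q.
Proof. by rewrite -[p]scale1r psiL mul1r scale1r. Qed.

Lemma lin_formZ x p : psi (x *: p) = x * psi p.
Proof. by rewrite -[x *: p]addr0 psiL lin_form0 addr0. Qed.

Lemma lin_formB p q : psi (p - q) = psi p - psi q.
Proof. by rewrite lin_formD -scaleN1r lin_formZ mulN1r. Qed.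

Lemma lin_form_sum (I : Type) (s : seq I) (f : I -> V) :
  psi (\sum_(i <- s) f i) = \sum_(i <- s) psi (f i).
Proof. exact: (big_morph psi lin_formD lin_form0). Qed.

End LinForm.

(** A maximal subspace containing [U] and avoiding [e] is a complement of the line spanned by [e];
    [psi] is the coordinate along [e]. *)
Lemma lin_form_separation (F : fieldType) (V : lmodType F) (U : V -> Prop) e :
  U 0 -> (forall x u v, U u -> U v -> U (x *: u + v)) -> ~ U e ->
  exists psi : V -> F, [/\ lin_form psi, forall u, U u -> psi u = 0 & psi e = 1].
Proof.
move=> U0 UL Ue.
pose good (X : set V) := [/\ forall u, U u -> X u,
  forall x u v, X u -> X v -> X (x *: u + v) & ~ X e].
have [W [gW maxW]] : exists W, good W /\ forall B, (W `<` B)%classic -> ~ good B.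
  have [|W [[W0|gW] maxW]] :=
    @Zorn_bigcup V (fun X => X = set0 \/ good X).
  - move=> C Cg Ct.
    have [[X0 [CX0 gX0]]|nX] := pselect (exists X0, C X0 /\ good X0); last first.
      left; apply/seteqP; split=> // v [X CX Xv].
      case: (Cg X CX) => [X0|gX]; first by rewrite X0 in Xv.
      by case: nX; exists X.
    right; split=> [u Uu|x u v [X CX Xu] [Y CY Yv]|[X CX Xe]].
    + by exists X0 => //; case: gX0 => H _ _; apply: H.
    + have [XY|YX] := Ct X Y CX CY.
        exists Y => //; have Yu := XY _ Xu; case: (Cg Y CY) => [Y0|[_ YL _]].
          by rewrite Y0 in Yu.
        exact: YL.
      exists X => //; have Xv := YX _ Yv; case: (Cg X CX) => [X1|[_ XL _]].
        by rewrite X1 in Xv.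
      exact: XL.
    + by case: (Cg X CX) => [X1|[_ _ /(_ Xe)//]]; rewrite X1 in Xe.
  - exfalso; apply: (maxW U); last by right.
    by rewrite W0; split=> [v //|/(_ 0 U0)].
  exists W; split=> // B WB gB; apply: (maxW B WB); by right.
have [UW WL We] := gW.
have W0 : W 0 by apply: UW.
have WZ x u : W u -> W (x *: u) by move=> Wu; rewrite -[_ *: _]addr0; apply: WL.
have WD u v : W u -> W v -> W (u + v) by move=> Wu Wv; rewrite -[u]scale1r; apply: WL.
have dec v : exists x, W (v - x *: e).
  have [Wv|Wv] := pselect (W v); first by exists 0; rewrite scale0r subr0.
  apply: contrapT => nx.
  pose B : set V := [set y | exists x w, W w /\ y = x *: v + w]%classic.
  have WB : (W `<` B)%classic.
    split=> [w Ww|]; first by exists 0, w; rewrite scale0r add0r.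
    by move/(_ v) => H; apply: Wv; apply: H; exists 1, 0; rewrite scale1r addr0.
  apply: (maxW B WB).
  split=> [u /UW Wu|x u w [y [u' [Wu' ->]]] [z [w' [Ww' ->]]]|[x [w [Ww E]]]].
  - by exists 0, u; rewrite scale0r add0r.
  - exists (x * y + z), (x *: u' + w'); split; first exact: WL.
    by rewrite scalerDr scalerA scalerDl addrACA.
  have [x0|x0] := eqVneq x 0; first by apply: We; rewrite E x0 scale0r add0r.
  apply: nx; exists x^-1; rewrite E scalerDr scalerA mulVf // scale1r opprD addrA.
  by rewrite subrr add0r -scaleN1r scalerA; apply: WZ.
pose psi v := projT1 (cid (dec v)).
have psiW v : W (v - psi v *: e) by rewrite /psi; case: (cid _).
have uniq v x : W (v - x *: e) -> psi v = x.
  move=> Wx; apply: contrapT => /eqP; rewrite -subr_eq0 => d0; apply: We.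
  have -> : e = (psi v - x)^-1 *: (v - x *: e + (-1) *: (v - psi v *: e)).
    by rewrite scaleN1r opprB [X in _ *: X]addrC addrA subrK -scalerBl scalerA mulVf // scale1r.
  by apply: (WZ); apply: (WD) => //; apply: (WZ).
exists psi; split=> [x p q|u Uu|].
- apply: uniq; have := WL x _ _ (psiW p) (psiW q).
  by rewrite scalerBr scalerA addrACA -opprD -scalerDl.
- by apply: uniq; rewrite scale0r subr0; apply: UW.
- by apply: uniq; rewrite scale1r subrr.
Qed.

(* [lia] gets lost in contexts containing ring-valued hypotheses. *)
Ltac nlia := repeat match goal with
  | H : is_true (leq _ _) |- _ => revert H
  | H : @eq nat _ _ |- _ => revert H
  end; clear; intros; lia.

(** * Coordinates adapted to a line *)

Section LineCoordinates.
Variables (F : numFieldType).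
Local Notation S := {mpoly F[3]}.
Variables (alpha beta ell : S) (rho : {rmorphism S -> {poly F}}).
Hypotheses (hal : alpha \is 1.-homog) (hbe : beta \is 1.-homog)
  (hel : ell \is 1.-homog).
Hypotheses (rhoC : forall c, rho c%:MP = c%:P) (rho_al : rho alpha = 'X)
  (rho_be : rho beta = 1) (rho_el : rho ell = 0).
Hypothesis span : forall i, exists x y z,
  'X_i = x *: alpha + y *: beta + z *: ell.
Implicit Types (p : S) (q : {poly F}).

Lemma rhoZ x p : rho (x *: p) = x *: rho p.
Proof. by rewrite -mul_mpolyC rmorphM rhoC mul_polyC. Qed.

(* [lam k] homogenizes: it is a section of [rho] in degree k. *)
Definition lam k q : S := \sum_(i < k.+1) q`_i *: (alpha ^+ i * beta ^+ (k - i)).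

Lemma lam_linear k x q q' : lam k (x *: q + q') = x *: lam k q + lam k q'.
Proof.
rewrite /lam scaler_sumr -big_split; apply: eq_bigr => i _ /=.
by rewrite coefD coefZ scalerDl scalerA.
Qed.

Lemma lam0 k : lam k 0 = 0.
Proof. by rewrite /lam big1 // => i _; rewrite coef0 scale0r. Qed.

Lemma lamD k q q' : lam k (q + q') = lam k q + lam k q'.
Proof. by rewrite -[q]scale1r lam_linear !scale1r. Qed.

Lemma lamZ k x q : lam k (x *: q) = x *: lam k q.
Proof. by rewrite -[x *: q]addr0 lam_linear lam0 addr0. Qed.

Lemma lam_sum k (I : Type) (s : seq I) (f : I -> {poly F}) :
  lam k (\sum_(i <- s) f i) = \sum_(i <- s) lam k (f i).
Proof. exact: (big_morph (lam k) (lamD k) (lam0 k)). Qed.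

Lemma dhomogX1 k p : p \is 1.-homog -> p ^+ k \is k.-homog.
Proof. by move=> hp; rewrite -[X in X.-homog]mul1n; apply: dhomogMn. Qed.

Lemma lam_homog k q : lam k q \is k.-homog.
Proof.
apply: rpred_sum => i _; apply: dhomogZ; have ik : (i <= k)%N by rewrite -ltnS.
by rewrite -[X in X.-homog](subnKC ik) dhomogM // dhomogX1.
Qed.

Lemma lamXn k i : (i <= k)%N -> lam k 'X^i = alpha ^+ i * beta ^+ (k - i).
Proof.
move=> ik; rewrite /lam (bigD1 (inord i)) //= inordK // coefXn eqxx scale1r.
rewrite big1 ?addr0 // => j; rewrite -val_eqE /= inordK // coefXn => /negPf ->.
by rewrite scale0r.
Qed.

Lemma poly_expand k q : (size q <= k.+1)%N -> q = \sum_(i < k.+1) q`_i *: 'X^i.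
Proof.
move=> qk; rewrite -(poly_def k.+1 (fun i => q`_i)); apply/polyP => i.
by rewrite coef_poly; case: ltnP => // ki; rewrite nth_default // (leq_trans qk).
Qed.

Lemma lamM k l q q' : (size q <= k.+1)%N -> (size q' <= l.+1)%N ->
  lam (k + l) (q * q') = lam k q * lam l q'.
Proof.
move=> /poly_expand qE /poly_expand qE'; rewrite {1}qE {1}qE' mulr_suml lam_sum.
rewrite [in RHS]/lam mulr_suml; apply: eq_bigr => i _.
rewrite mulr_sumr lam_sum mulr_sumr; apply: eq_bigr => j _.
have [ik jl] : (i <= k)%N /\ (j <= l)%N by split; rewrite -ltnS.
rewrite -scalerAl -scalerAr !lamZ -exprD lamXn ?leq_add //.
rewrite -scalerAl -scalerAr !scalerA; congr (_ *: _).
have -> : (k + l - (i + j) = (k - i) + (l - j))%N by nlia.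
by rewrite !exprD; ring.
Qed.

Lemma rho_lam k q : (size q <= k.+1)%N -> rho (lam k q) = q.
Proof.
move=> /poly_expand {2}->; rewrite rmorph_sum; apply: eq_bigr => i _.
by rewrite rhoZ rmorphM !rmorphXn /= rho_al rho_be expr1n mulr1.
Qed.

Lemma rho_homog k p : p \is k.-homog -> (size (rho p) <= k.+1)%N.
Proof.
move=> hp; move: k p hp; apply: dhomog_ind => [k|c|i|k p q Hp Hq|k l p q Hp Hq].
- by rewrite rmorph0 size_poly0.
- by rewrite rhoC size_polyC; case: eqP.
- have [x [y [z ->]]] := span i.
  rewrite !rmorphD /= !rhoZ rho_al rho_be rho_el scaler0 addr0.
  rewrite (leq_trans (size_polyD _ _)) // geq_max.
  by rewrite !(leq_trans (size_scale_leq _ _)) // ?size_polyX // size_poly1.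
- by rewrite rmorphD (leq_trans (size_polyD _ _)) // geq_max Hp.
rewrite rmorphM; apply: leq_trans (size_polyMleq _ _) _.
by move: (size (rho p)) (size (rho q)) Hp Hq => a b; nlia.
Qed.

Lemma lam_rho k p : p \is k.-homog -> mdvd ell (p - lam k (rho p)).
Proof.
(* The size bound joins the induction because [lamM] needs it for products. *)
move=> hp; suff: (size (rho p) <= k.+1)%N /\ mdvd ell (p - lam k (rho p)) by case.
move: k p hp; apply: dhomog_ind => [k|c|i|k p q [Sp Hp] [Sq Hq]|k l p q [Sp Hp] [Sq Hq]].
- by rewrite rmorph0 lam0 subr0 size_poly0; split=> //; apply: mdvd0.
- split; first exact/rho_homog/dhomogC.
  rewrite rhoC /lam big_ord1 coefC eqxx !expr0 mulr1 -mul_mpolyC mulr1 subrr.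
  exact: mdvd0.
- split; first exact/rho_homog/dhomogXi.
  have [x [y [z ->]]] := span i.
  rewrite !rmorphD /= !rhoZ rho_al rho_be rho_el scaler0 addr0.
  have l1 : lam 1 'X = alpha by rewrite -['X]expr1 lamXn // expr1 expr0 mulr1.
  have l0 : lam 1 1 = beta by rewrite -(expr0 'X) lamXn // expr0 mul1r expr1.
  rewrite lamD !lamZ l1 l0.
  by exists z%:MP; rewrite addrAC subrr add0r mulrC mul_mpolyC.
- split; first by rewrite rmorphD (leq_trans (size_polyD _ _)) // geq_max Sp.
  by rewrite rmorphD lamD opprD addrACA; apply: mdvdD.
split.
  rewrite rmorphM; apply: leq_trans (size_polyMleq _ _) _.
  by move: (size (rho p)) (size (rho q)) Sp Sq => a b; nlia.
rewrite rmorphM lamM //.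
have -> : p * q - lam k (rho p) * lam l (rho q) =
  (p - lam k (rho p)) * q + lam k (rho p) * (q - lam l (rho q)) by ring.
by apply: mdvdD; [apply: mdvd_mulr | apply: mdvd_mull].
Qed.

(** In degree 0 the truncated [k.-1] would allow a constant quotient; the last clause excludes
    it. *)
Lemma ell_quotient k p : p \is k.-homog -> mdvd ell p ->
  exists w, [/\ p = ell * w, w \is (k.-1).-homog & k = 0%N -> w = 0].
Proof.
move=> hp Hp; case: k hp => [|k] hp; last first.
  have [w hw pE] := mdvd_homogE hel hp Hp; exists w; split => //.
  by move: hw; rewrite subSS subn0.
exists 0; split=> //; rewrite ?rpred0 // mulr0.
exact: mdvd_lt_deg hel hp _ Hp.
Qed.

Lemma lam_rho_quotient k p : p \is k.-homog ->
  exists w, [/\ p = lam k (rho p) + ell * w, w \is (k.-1).-homog & k = 0%N -> w = 0].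
Proof.
move=> hp; have hd := dhomogB hp (lam_homog k (rho p)).
have [w [E hw w0]] := ell_quotient hd (lam_rho hp).
by exists w; split=> //; rewrite -E addrC subrK.
Qed.

Lemma ker_rho k p : p \is k.-homog -> rho p = 0 -> exists w, p = ell * w.
Proof.
by move=> hp p0; have [w [-> _ _]] := lam_rho_quotient hp; exists w; rewrite p0 lam0 add0r.
Qed.

(** * The ideal of two forms coprime on the line *)

Section Linkage.
Variables (n : nat) (g1 g2 g3 : S).
Hypotheses (n_gt1 : (1 < n)%N) (hg1 : g1 \is n.-homog) (hg2 : g2 \is n.-homog)
  (hg3 : g3 \is n.-homog).
Hypotheses (size_rg1 : size (rho g1) = n.+1)
  (cop : coprimep (rho g1) (rho g2)) (ell_neq0 : ell != 0).
Local Notation a := (rho g1).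
Local Notation b := (rho g2).

Definition inG p := exists u v, p = g1 * u + g2 * v.

Lemma inGD p p' : inG p -> inG p' -> inG (p + p').
Proof.
case=> u [v ->] [u' [v' ->]]; exists (u + u'), (v + v').
by rewrite !mulrDr addrACA.
Qed.

Lemma inGM p p' : inG p -> inG (p * p').
Proof. by case=> u [v ->]; exists (u * p'), (v * p'); rewrite mulrDl !mulrA. Qed.

Lemma inG0 : inG 0.
Proof. by exists 0, 0; rewrite !mulr0 addr0. Qed.

Lemma inG_sum (I : Type) (s : seq I) (f : I -> S) :
  (forall i, inG (f i)) -> inG (\sum_(i <- s) f i).
Proof. move=> H; elim/big_rec: _ => [|i p _]; [exact: inG0 | exact: inGD]. Qed.

Lemma inG_homog k p : p \is k.-homog -> inG p ->
  exists u v, [/\ u \is (k - n).-homog, v \is (k - n).-homog & p = g1 * u + g2 * v].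
Proof.
move=> hp [u [v E]].
have [kn|nk] := ltnP k n.
  exists 0, 0; split; rewrite ?rpred0 // !mulr0 addr0.
  by rewrite -(pihomog_dE hp) E linearD /= !(pihomogM _ _ hg1, pihomogM _ _ hg2) kn addr0.
exists (pihomog mdeg (k - n) u), (pihomog mdeg (k - n) v).
split; rewrite ?pihomogP //.
rewrite -[LHS](pihomog_dE hp) E linearD /= (pihomogM _ _ hg1) (pihomogM _ _ hg2).
by rewrite ltnNge nk.
Qed.

(** Coprimality makes the syzygies of [a] and [b] multiples of (- b, a); [W] lifts the multiplier
    off the line, and the remainder, zero on the line, is divisible by [ell]. *)
Lemma rho_syzygy k u v : u \is k.-homog -> v \is k.-homog ->
  a * rho u + b * rho v = 0 ->
  exists W u' v', [/\ u = ell * u' - g2 * W, v = ell * v' + g1 * W,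
    u' \is (k.-1).-homog, v' \is (k.-1).-homog & k = 0%N -> u' = 0 /\ v' = 0].
Proof.
move=> hu hv /eqP; rewrite addr_eq0 => /eqP E1.
have : a %| b * rho v by rewrite -dvdpNr -E1 dvdp_mulIl.
rewrite Gauss_dvdpr // => /dvdpP[w Ev].
have a0 : a != 0 by rewrite -size_poly_gt0 size_rg1.
have Eu : rho u = - (b * w) by apply: (mulfI a0); rewrite E1 Ev; ring.
have [W hW rW] : exists2 W, g2 * W \is k.-homog /\ g1 * W \is k.-homog & rho W = w.
  have [->|w0] := eqVneq w 0; first by exists 0; rewrite ?rmorph0 // !mulr0 rpred0.
  have := rho_homog hv; rewrite Ev size_mul // size_rg1 addnS /= => sw.
  have w1 : (0 < size w)%N by rewrite size_poly_gt0.
  have nk : (n <= k)%N by move: (size w) sw w1 => *; nlia.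
  exists (lam (k - n) w); last by apply: rho_lam; move: (size w) sw w1 => *; nlia.
  by split; rewrite -[X in X.-homog](subnKC nk) dhomogM // lam_homog.
have [hW2 hW1] := hW; exists W.
have hu' := dhomogD hu hW2; have hv' := dhomogB hv hW1.
have [|u' [Eu' hu'' u0]] := ell_quotient hu'.
  have [|u' ->] := ker_rho hu'; last by exists u'.
  by rewrite rmorphD rmorphM rW Eu addNr.
have [|v' [Ev' hv'' v0]] := ell_quotient hv'.
  have [|v' ->] := ker_rho hv'; last by exists v'.
  by rewrite rmorphB rmorphM rW Ev mulrC subrr.
exists u', v'; split=> //; rewrite -?Eu' -?Ev' ?addrK ?subrK //.
by move=> k0; rewrite u0 ?v0.
Qed.

(** Restricting [ell * p = g1 * u + g2 * v] to the line gives a syzygy of [a] and [b]; its Koszul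
    part cancels and the rest is divisible by [ell]. *)
Lemma ell_saturated k p : p \is k.-homog -> inG (ell * p) -> inG p.
Proof.
move=> hp Gp; have hep := dhomogM hel hp.
have [u [v [hu hv E]]] := inG_homog hep Gp.
have [|W [u' [v' [Eu Ev _ _ _]]]] := rho_syzygy hu hv.
  by rewrite -!rmorphM -rmorphD -E rmorphM rho_el mul0r.
exists u', v'; apply: (mulfI ell_neq0).
by rewrite E Eu Ev; ring.
Qed.

Lemma ellX_saturated k m p : p \is k.-homog -> inG (ell ^+ m * p) -> inG p.
Proof.
move=> hp; elim: m => [|m IH]; first by rewrite mul1r.
rewrite exprS -mulrA => /(ell_saturated (dhomogM (dhomogX1 m hel) hp)); exact: IH.
Qed.

(** Descent on the degree: modulo [ell] the syzygy is Koszul, and the quotients by [ell] of what is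
    left form a syzygy one degree lower. *)
Lemma syzygy_g12 k u v : u \is k.-homog -> v \is k.-homog ->
  g1 * u + g2 * v = 0 ->
  exists2 W, W \is (k - n).-homog & u = g2 * W /\ v = - (g1 * W).
Proof.
move=> hu hv E.
have b0 : b != 0.
  apply: contraTneq cop => ->; rewrite coprimep0 -size_poly_eq1 size_rg1.
  by rewrite eqSS -lt0n ltnW.
have g20 : g2 != 0 by apply: contra_neq b0 => ->; rewrite rmorph0.
have [W [uE vE]] : exists W, u = g2 * W /\ v = - (g1 * W).
  elim: k u v hu hv E => [|k IH] u v hu hv E.
    have [|W [u' [v' [-> -> _ _ []// -> ->]]]] := rho_syzygy hu hv.
      by rewrite -!rmorphM -rmorphD E rmorph0.
    by exists (- W); split; ring.
  have [|W [u' [v' [Eu Ev hu' hv' _]]]] := rho_syzygy hu hv.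
    by rewrite -!rmorphM -rmorphD E rmorph0.
  have [|W' [Eu' Ev']] := IH u' v' hu' hv'.
    by apply: (mulfI ell_neq0); rewrite mulr0 -E Eu Ev; ring.
  by exists (ell * W' - W); rewrite Eu Ev Eu' Ev'; split; ring.
have [|W' hW' uE'] := mdvd_homogE hg2 hu; first by exists W.
exists W' => //; split => //; rewrite vE; congr (- (_ * _)).
by apply: (mulfI g20); rewrite -uE -uE'.
Qed.

(* The linear forms on S / (g1, g2, ell - 1), that is on the coordinate ring of
   the complete intersection g1 = g2 = 0 in the affine chart ell = 1. *)
Definition glin (psi : S -> F) := [/\ lin_form psi, forall p, psi (g1 * p) = 0,
  forall p, psi (g2 * p) = 0 & forall p, psi (ell * p) = psi p].

Lemma glin_inG psi p : glin psi -> inG p -> psi p = 0.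
Proof. by case=> L P1 P2 _ [u [v ->]]; rewrite lin_formD // P1 P2 addr0. Qed.

Lemma glin_ellX psi m p : glin psi -> psi (ell ^+ m * p) = psi p.
Proof.
move=> [_ _ _ Pe]; elim: m => [|m IH]; first by rewrite mul1r.
by rewrite exprS -mulrA Pe.
Qed.

Lemma glin_mul psi h : glin psi -> glin (fun p => psi (h * p)).
Proof.
case=> L P1 P2 Pe; split => [x p q|p|p|p] /=.
- by rewrite mulrDr -scalerAr L.
- by rewrite mulrCA P1.
- by rewrite mulrCA P2.
- by rewrite mulrCA Pe.
Qed.

Lemma glin_sub psi psi' : glin psi -> glin psi' -> glin (fun p => psi p - psi' p).
Proof.
case=> L P1 P2 Pe [L' P1' P2' Pe']; split => [x p q|p|p|p] /=.
- by rewrite L L'; ring.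
- by rewrite P1 P1' subrr.
- by rewrite P2 P2' subrr.
- by rewrite Pe Pe'.
Qed.

(* A graded lift of the reduction modulo ell - 1, used to turn identities modulo
   ell - 1 into homogeneous ones. *)
Definition hom_to N p : S := \sum_(i < N.+1) ell ^+ (N - i) * pihomog mdeg i p.

Lemma hom_toD N p p' : hom_to N (p + p') = hom_to N p + hom_to N p'.
Proof.
by rewrite /hom_to -big_split; apply: eq_bigr => i _; rewrite linearD mulrDr.
Qed.

Lemma hom_to0 N : hom_to N 0 = 0.
Proof. by rewrite /hom_to big1 // => i _; rewrite linear0 mulr0. Qed.

Lemma hom_toN N p : hom_to N (- p) = - hom_to N p.
Proof. by apply/eqP; rewrite -addr_eq0 -hom_toD addNr hom_to0. Qed.

Lemma hom_to_sum N (I : Type) (s : seq I) (f : I -> S) :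
  hom_to N (\sum_(i <- s) f i) = \sum_(i <- s) hom_to N (f i).
Proof. exact: (big_morph (hom_to N) (hom_toD N) (hom_to0 N)). Qed.

Lemma hom_to_homog N k p : p \is k.-homog -> (k <= N)%N ->
  hom_to N p = ell ^+ (N - k) * p.
Proof.
move=> hp kN; rewrite /hom_to (bigD1 (inord k)) //= inordK // pihomog_dE //.
rewrite big1 ?addr0 // => i; rewrite -val_eqE /= inordK // => ik.
by rewrite (pihomog_ne0 _ hp) ?mulr0 // eq_sym.
Qed.

Lemma pihomog_sumW m p : (msize p <= m)%N -> p = \sum_(k < m) pihomog mdeg k p.
Proof. by move=> pm; apply: pihomog_partitionE. Qed.

(** Separate [t * e] from the sum of the ideal (g1, g2, ell - 1) and of [t] times the polynomials of
    degree below [m]. If it belonged to this sum, homogenizing with [ell] and cancelling powers of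
    [ell] would produce the excluded [q]. *)
Lemma glin_exists m tau (t e : S) : (0 < m)%N -> t \is tau.-homog -> e \is m.-homog ->
  (forall q : S, q \is (m.-1).-homog -> ~ inG (t * (e - ell * q))) ->
  exists psi, [/\ glin psi, psi (t * e) <> 0 &
    forall i (q : S), q \is i.-homog -> (i < m)%N -> psi (t * q) = 0].
Proof.
move=> m0 ht he H.
pose U x := exists u v w q : S, (msize q <= m)%N /\
  x = g1 * u + g2 * v + (ell * w - w) + t * q.
have [||Ue|psi [L PU Pe]] := @lin_form_separation F S U (t * e).
- by exists 0, 0, 0, 0; rewrite msize0 !mulr0 subr0 !addr0.
- move=> x _ _ [u [v [w [q [qm ->]]]]] [u' [v' [w' [q' [qm' ->]]]]].
  exists (x *: u + u'), (x *: v + v'), (x *: w + w'), (x *: q + q'); split.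
    rewrite (leq_trans (msizeD_le _ _)) // geq_max qm' andbT.
    exact: leq_trans (msizeZ_le _ _) qm.
  rewrite -!mul_mpolyC; ring.
- case: Ue => u [v [w [q [qm E]]]].
  have [N [uN vN wN tN]] : exists N, [/\ (n + msize u <= N)%N, (n + msize v <= N)%N,
      (msize w <= N)%N & (tau + m <= N)%N].
    exists (n + msize u + msize v + msize w + tau + m)%N.
    by move: (msize u) (msize v) (msize w); clear; move=> *; split; nlia.
  have hG g r : g \is n.-homog -> (forall p, inG (g * p)) -> (n + msize r <= N)%N ->
      inG (hom_to N (g * r)).
    move=> hg Gg rN; rewrite (pihomog_sum r) mulr_sumr hom_to_sum.
    apply: inG_sum => i; rewrite (@hom_to_homog _ (n + i)).
    - by rewrite mulrCA; apply: Gg.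
    - by rewrite dhomogM // pihomogP.
    - by apply: leq_trans rN; rewrite leq_add2l ltnW.
  have hW : hom_to N (ell * w - w) = 0.
    rewrite hom_toD hom_toN (pihomog_sum w) mulr_sumr !hom_to_sum -sumrB big1 // => i _.
    have hi := pihomogP [measure of mdeg] i w.
    have iN : (i.+1 <= N)%N by apply: leq_trans wN.
    rewrite (@hom_to_homog _ (1 + i)) ?dhomogM // (hom_to_homog hi (ltnW iN)).
    by rewrite mulrA -exprSr add1n -subSn // subrr.
  pose q' : S := \sum_(i < m) ell ^+ (m.-1 - i) * pihomog mdeg i q.
  have hq' : q' \is (m.-1).-homog.
    apply: rpred_sum => i _; have im : (i <= m.-1)%N by rewrite -ltnS prednK.
    have := dhomogM (dhomogX1 (m.-1 - i) hel) (pihomogP [measure of mdeg] i q).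
    by rewrite subnK.
  have hQ : hom_to N (t * q) = ell ^+ (N - tau - m) * (t * (ell * q')).
    rewrite (pihomog_sumW qm) mulr_sumr hom_to_sum /q' !mulr_sumr.
    apply: eq_bigr => i _; have im := ltn_ord i.
    rewrite (@hom_to_homog _ (tau + i)) ?dhomogM ?pihomogP //; last first.
      by move: (nat_of_ord i) im tN; clear; move=> *; nlia.
    have -> : (N - (tau + i) = (N - tau - m) + (m.-1 - i).+1)%N.
      by move: (nat_of_ord i) im tN; clear; move=> *; nlia.
    by rewrite exprD exprS; ring.
  have hE : hom_to N (t * e) = ell ^+ (N - tau - m) * (t * e).
    by rewrite (@hom_to_homog _ (tau + m)) ?dhomogM // subnDA.
  apply: (H q' hq'); apply: (@ellX_saturated (tau + m) (N - tau - m)).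
    by rewrite dhomogM // dhomogB //; have := dhomogM hel hq'; rewrite add1n prednK.
  have -> : ell ^+ (N - tau - m) * (t * (e - ell * q')) = hom_to N (t * e) - hom_to N (t * q).
    by rewrite hE hQ; ring.
  rewrite E hom_toD addrK hom_toD hW addr0 hom_toD; apply: inGD; apply: hG => //.
  + by move=> p; exists p, 0; rewrite mulr0 addr0.
  + by move=> p; exists 0, p; rewrite mulr0 add0r.
exists psi; split.
- split=> // [p|p|p].
  + by apply: PU; exists p, 0, 0, 0; rewrite msize0 !mulr0 subr0 !addr0.
  + by apply: PU; exists 0, p, 0, 0; rewrite msize0 !mulr0 subr0 !addr0 add0r.
  apply/eqP; rewrite -subr_eq0 -lin_formB //; apply/eqP/PU.
  by exists 0, 0, p, 0; rewrite msize0 !mulr0 !addr0 add0r.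
- by rewrite Pe; apply/eqP/oner_neq0.
move=> i q hq im; apply: PU; exists 0, 0, 0, q; rewrite !mulr0 subr0 !add0r; split=> //.
have [->|q0] := eqVneq q 0; first by rewrite msize0.
rewrite -mlead_deg //.
by move/dhomogP: hq => /(_ _ (mlead_supp q0)) /= ->.
Qed.


(** [p] and the lift of its restriction differ by [ell * w] with [w] of degree [M - 1], and
    [psi (ell * w) = psi w = 0]. *)
Lemma glin_lam psi M p : glin psi -> p \is M.-homog ->
  (forall i (q : S), q \is i.-homog -> (i < M)%N -> psi q = 0) ->
  psi p = psi (lam M (rho p)).
Proof.
move=> Gpsi hp psi0; have [L _ _ Pe] := Gpsi.
have [w [E hw w0]] := lam_rho_quotient hp.
rewrite [in LHS]E lin_formD // Pe; case: M hw w0 {hp E} psi0 => [|M] hw w0 psi0.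
  by rewrite w0 // lin_form0 // addr0.
by rewrite (psi0 M w hw) // addr0.
Qed.

Lemma invertible_mod : exists c, a %| b * c - 1.
Proof.
have [[u v] /= E] := Bezout_eq1_coprimepP _ _ cop; exists v.
by rewrite -E opprD addrCA [b * v]mulrC subrr addr0 -mulNr dvdp_mulIr.
Qed.

(** * Macaulay duality lifted from the line *)

Section Socle.
Variable c : {poly F}.
Hypothesis bcK : a %| b * c - 1.
Local Notation soc := (socle n a c).

Let n_gt0 : (0 < n)%N. Proof. exact: ltnW. Qed.
Let size_b : (size b <= n.+1)%N. Proof. exact: rho_homog. Qed.

(** On forms of degree [M], [psi] factors through the line by [glin_lam]; there it kills the
    multiples of [a] and [b], and binary duality applies. *)
Lemma glin_socle psi K M : glin psi -> (K + M = (n + n).-2)%N ->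
  (forall i (q : S), q \is i.-homog -> (i < M)%N -> psi q = 0) ->
  exists2 h : {poly F}, (size h <= K.+1)%N &
    forall p, p \is M.-homog -> psi p = soc (h * rho p).
Proof.
move=> Gpsi KM psi0; have [L P1 P2 Pe] := Gpsi.
have chiL : linear (fun q => psi (lam M q) : F^o).
  by move=> x q q' /=; rewrite lam_linear L.
pose chiM := GRing.isLinear.Build F {poly F} F^o _ _ chiL.
pose chi : {linear {poly F} -> F^o} := HB.pack (fun q => psi (lam M q) : F^o) chiM.
have chi0 g q : g \is n.-homog -> (forall p, psi (g * p) = 0) ->
    (size q <= M.+1 - n)%N -> chi (rho g * q) = 0.
  move=> hg Pg qM; have [nM|Mn] := leqP n M; last first.
    have -> : q = 0.
      by apply/eqP; rewrite -size_poly_leq0; apply: leq_trans qM _; nlia.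
    by rewrite mulr0 linear0.
  rewrite /chi /= -(@rho_lam (M - n) q); last by rewrite -subSn.
  rewrite -rmorphM -glin_lam // -[X in X.-homog](subnKC nM) dhomogM // lam_homog //.
have [|q|h hK hE] := socle_perfect n_gt0 size_rg1 size_b bcK (chi := chi) KM.
- by move=> q; apply: chi0.
- exact: chi0.
exists h => // p hp; rewrite (glin_lam Gpsi hp psi0) -hE //.
exact: rho_homog.
Qed.

(** [Phi] will generate the dual of the Frobenius algebra. It comes from separation with [t = 1] in
    the socle degree 2 n - 2, where duality with [K = 0] makes it a scalar multiple of the binary
    socle. *)
Lemma socle_form : exists Phi kappa, [/\ glin Phi, kappa != 0,
  forall i (q : S), q \is i.-homog -> (i < (n + n).-2)%N -> Phi q = 0 &
  forall p, p \is ((n + n).-2).-homog -> Phi p = kappa * soc (rho p)].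
Proof.
have [p0 sp0 p0n] := socle_neq0 n_gt0 size_rg1 size_b bcK.
have sp0' : (size p0 <= (n + n).-2.+1)%N by apply: leq_trans sp0 _; nlia.
have n2 : (0 < (n + n).-2)%N by nlia.
have [|Phi [GP Pe P0]] :=
  @glin_exists (n + n).-2 0 1 (lam (n + n).-2 p0) n2 (dhomog1 _ _) (lam_homog _ _).
  move=> q hq; rewrite mul1r => G.
  have hd : lam (n + n).-2 p0 - ell * q \is ((n + n).-2).-homog.
    by rewrite dhomogB ?lam_homog //; have := dhomogM hel hq; rewrite add1n prednK.
  have [u [v [hu hv E]]] := inG_homog hd G.
  have := congr1 rho E; rewrite rmorphB rmorphM rho_el mul0r subr0 rho_lam // => p0E.
  move/eqP: p0n; apply.
  (* [rho v] has degree at most n - 2, while [topc] reads the coefficient of degree n - 1. *)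
  rewrite p0E rmorphD !rmorphM (socleD) (socle_a _) (socle_b _ bcK) add0r /topc.
  have sv := rho_homog hv.
  have sv' : (size (rho v) <= n.-1)%N by apply: leq_trans sv _; nlia.
  rewrite modp_small ?nth_default // size_rg1 ltnS (leq_trans sv') //; nlia.
have Phi0 i (q : S) : q \is i.-homog -> (i < (n + n).-2)%N -> Phi q = 0.
  by move=> hq im; rewrite -[q]mul1r (P0 i).
have [h h1 hE] := @glin_socle Phi 0 (n + n).-2 GP (add0n _) Phi0.
exists Phi, h`_0; split => //.
  apply: contra_notN Pe => /eqP h0; rewrite mul1r hE ?lam_homog //.
  by rewrite (size1_polyC h1) h0 mul0r /socle mul0r /topc mod0p coef0.
move=> p hp; rewrite hE // {1}(size1_polyC h1) mul_polyC socleZ //.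
Qed.

Section Duality.
Variables (Phi : S -> F) (kappa : F).
Hypotheses (GPhi : glin Phi) (kappa_neq0 : kappa != 0).
Hypothesis Phi0 : forall i (q : S), q \is i.-homog -> (i < (n + n).-2)%N -> Phi q = 0.
Hypothesis PhiE : forall p, p \is ((n + n).-2).-homog -> Phi p = kappa * soc (rho p).

Lemma reduce_mod_ell j p : p \is j.-homog ->
  (forall q, (j + size q <= (n + n).-1)%N -> soc (rho p * q) = 0) ->
  exists w, [/\ inG (p - ell * w), w \is (j.-1).-homog & j = 0%N -> w = 0].
Proof.
move=> hp H.
have [u [v [E su sv]]] := socle_nondeg n_gt0 size_rg1 size_b bcK (rho_homog hp) H.
have hlam g q : g \is n.-homog -> (size q <= j.+1 - n)%N ->
    g * lam (j - n) q \is j.-homog /\ rho (lam (j - n) q) = q.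
  move=> hg sq; have [nj|jn] := leqP n j.
    rewrite rho_lam -?subSn //; split=> //.
    by rewrite -[X in X.-homog](subnKC nj) dhomogM // lam_homog.
  have -> : q = 0 by apply/eqP; rewrite -size_poly_leq0; apply: leq_trans sq _; nlia.
  by rewrite lam0 mulr0 rmorph0 rpred0.
have [hu ru] := hlam g1 u hg1 su; have [hv rv] := hlam g2 v hg2 sv.
have hd := dhomogB hp (dhomogD hu hv).
have [|w [Ew hw w0]] := ell_quotient hd.
  have [|w ->] := ker_rho hd; last by exists w.
  by rewrite rmorphB rmorphD !rmorphM ru rv E subrr.
exists w; split=> //; rewrite -Ew opprB addrCA subrr addr0.
by exists (lam (j - n) u), (lam (j - n) v).
Qed.

Lemma soc0 : soc 0 = 0.
Proof. by rewrite /socle mul0r /topc mod0p coef0. Qed.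

Lemma glin_inG_sub psi p w : glin psi -> inG (p - ell * w) -> psi p = psi w.
Proof.
move=> Gpsi /(glin_inG Gpsi); have [L _ _ Pe] := Gpsi.
by rewrite lin_formB // Pe => /eqP; rewrite subr_eq0 => /eqP.
Qed.

(** From degree 2 n - 1 on, every binary form lies in the ideal of [a] and [b]; so a form of such a
    degree is [ell * w] modulo the ideal, and [psi] is determined by lower degrees. *)
Lemma glin_eq0 psi : glin psi ->
  (forall i (q : S), q \is i.-homog -> (i < (n + n).-1)%N -> psi q = 0) ->
  forall p, psi p = 0.
Proof.
move=> Gpsi psi0 p; have [L _ _ Pe] := Gpsi.
rewrite [p]pihomog_sum lin_form_sum // big1 // => i _.
have := pihomogP [measure of mdeg] i p.
move: (nat_of_ord i) (pihomog _ _ _) => k q; elim: k q {i p} => [|j IH] p hp.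
  by rewrite (psi0 _ _ hp) //; nlia.
have [jn|nj] := ltnP j.+1 (n + n).-1; first exact: psi0 hp jn.
have [|w [/(glin_inG_sub Gpsi) -> hw _]] := reduce_mod_ell hp; last exact: IH.
move=> q jq; have -> : q = 0.
  by apply/eqP; rewrite -size_poly_leq0; move: (size q) jq => *; nlia.
by rewrite mulr0 soc0.
Qed.

(** Cancel [psi] in the lowest degree where it may be nonzero by [Phi (hk * _)], with [hk] of
    complementary degree. What remains kills one more degree, and its multiplier is brought to the
    degree of [hk] by [ell], which [Phi] ignores. *)
Lemma glin_dual K psi : (K < n + n)%N -> glin psi ->
  (forall i (q : S), q \is i.-homog -> (i + K < (n + n).-1)%N -> psi q = 0) ->
  exists h, [/\ h \is (K.-1).-homog, K = 0%N -> h = 0 & forall p, psi p = Phi (h * p)].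
Proof.
have [LPhi _ _ Phie] := GPhi.
elim: K psi => [|K IH] psi Kn Gpsi psi0.
  exists 0; split; rewrite ?rpred0 // => p; rewrite mul0r lin_form0 //.
  by apply: glin_eq0 => // i q hq im; apply: psi0 hq _; rewrite addn0.
pose M := ((n + n).-2 - K)%N; have KM : (K + M = (n + n).-2)%N by rewrite /M; nlia.
have [|h hK hE] := glin_socle Gpsi KM.
  by move=> i q hq iM; apply: psi0 hq _; nlia.
pose hk := kappa^-1 *: lam K h.
have hhk : hk \is K.-homog by rewrite dhomogZ // lam_homog.
have Gd := glin_sub Gpsi (glin_mul hk GPhi).
have [||h' [hh' h'0 h'E]] := IH _ _ Gd; first exact: ltnW.
  move=> i q hq iK; have [iM|Mi] := ltnP i M.
    rewrite (psi0 _ _ hq) ?sub0r; last by nlia.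
    by rewrite (Phi0 (dhomogM hhk hq)) ?oppr0 //; nlia.
  have iM : i = M by nlia.
  rewrite iM in hq; rewrite (hE _ hq) PhiE; last by rewrite -KM dhomogM.
  rewrite rmorphM /hk rhoZ rho_lam // -scalerAl socleZ mulrA divff // mul1r.
  by rewrite subrr.
exists (hk + ell * h'); split=> // [|p].
  rewrite dhomogD //; case: K Kn hh' h'0 {IH psi0 M KM hk hhk hK hE Gd h'E} => [|K] Kn hh' h'0.
    by rewrite h'0 // mulr0 rpred0.
  by have := dhomogM hel hh'; rewrite add1n.
have := h'E p => /eqP; rewrite subr_eq => /eqP ->.
by rewrite mulrDl lin_formD // -mulrA Phie addrC.
Qed.

Lemma Phi_test j (e : S) q : e \is j.-homog -> (forall p, Phi (e * p) = 0) ->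
  (j + size q <= (n + n).-1)%N -> soc (rho e * q) = 0.
Proof.
move=> he H jq; have [->|q0] := eqVneq q 0; first by rewrite mulr0 soc0.
have q1 : (0 < size q)%N by rewrite size_poly_gt0.
pose m := ((n + n).-2 - j)%N; have jm : (j + m = (n + n).-2)%N by rewrite /m; nlia.
have qm : (size q <= m.+1)%N by rewrite /m; nlia.
have hp := dhomogM he (lam_homog m q); rewrite jm in hp.
have := PhiE hp; rewrite H rmorphM rho_lam // => /esym/eqP.
by rewrite mulf_eq0 (negPf kappa_neq0) => /eqP.
Qed.

(** Restricted to the line, [e] pairs to zero up to the complementary degree, so it is [ell * w]
    modulo the ideal; [w] inherits the hypothesis because [Phi] ignores [ell]. *)
Lemma Phi_nondeg j (e : S) : e \is j.-homog -> (forall q : S, Phi (e * q) = 0) -> inG e.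
Proof.
have [LPhi _ _ Phie] := GPhi.
elim: j e => [|j IH] e he H.
  have [|w [G _ w0]] := reduce_mod_ell he; last first.
    by rewrite w0 // mulr0 subr0 in G.
  move=> q jq; exact: (Phi_test he H jq).
have [|w [G hw _]] := reduce_mod_ell he; first by move=> q jq; exact: (Phi_test he H jq).
rewrite -[e](subrK (ell * w)); apply: inGD => //.
rewrite mulrC; apply: inGM; apply: (IH w hw) => q.
have := glin_inG_sub (glin_mul q GPhi) G; rewrite /= [q * w]mulrC => <-.
by rewrite mulrC H.
Qed.

End Duality.
End Socle.

(* The element [h] below is the linkage partner: a functional killing the
   colon ideal (g1, g2) : g3 is a multiple of Phi both by [h], of degree at
   most n - 2, and by g3 times something. *)
Lemma linkage e :
  (forall h, h \is (n - 2).-homog ->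
     (exists N u v w, ell ^+ N * h = g1 * u + g2 * v + g3 * w) -> h = 0) ->
  e \is n.-homog ->
  exists2 q : S, q \is (n.-1).-homog & inG (g3 * (e - ell * q)).
Proof.
move=> Hsat he; apply: contrapT => H.
have n_gt0 : (0 < n)%N by apply: ltnW.
have [c bcK] := invertible_mod.
have [Phi [kappa [GPhi k0 Phi0 PhiE]]] := socle_form bcK.
have [|psi [Gpsi Pe P0]] := glin_exists n_gt0 hg3 he.
  by move=> q hq Gq; apply: H; exists q.
(* [K = 2 n - 1] asks for no vanishing of [psi] and yields [y] of degree 2 n - 2; [psi (g3 * _)]
   kills degrees below [n], so [K = n - 1] yields [h] of degree n - 2. *)
have n2 : ((n + n).-1 < n + n)%N by nlia.
have [|y [hy _ yE]] := glin_dual bcK GPhi k0 Phi0 PhiE n2 Gpsi.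
  by move=> i q _; nlia.
have n3 : (n.-1 < n + n)%N by nlia.
have [|h [hh _ hE]] := glin_dual bcK GPhi k0 Phi0 PhiE n3 (glin_mul g3 Gpsi).
  by move=> i q hq iN; apply: P0 hq _; nlia.
have [L _ _ Pell] := GPhi.
(* Both terms have degree 3 n - 2, and [Phi] kills all multiples of the difference, as
   [psi (g3 * q)] equals both [Phi (h * q)] and [Phi (g3 * y * q)]. *)
have hd : ell ^+ (n + n) * h - g3 * y \is (n + (n + n).-2).-homog.
  apply: dhomogB; last by apply: dhomogM.
  have -> : (n + (n + n).-2 = (n + n) + n.-2)%N by nlia.
  by apply: dhomogM => //; apply: dhomogX1.
have [|u [v E]] := Phi_nondeg bcK GPhi k0 PhiE hd.
  move=> q; rewrite mulrBl lin_formB // -mulrA glin_ellX // -hE /=.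
  by rewrite yE; apply/eqP; rewrite subr_eq0; apply/eqP; congr Phi; ring.
apply: Pe; rewrite hE; have -> : h = 0; last by rewrite mul0r lin_form0.
apply: Hsat; first by rewrite subn2.
by exists (n + n)%N, u, v, y; rewrite -E subrK.
Qed.

Lemma large_degree j p : p \is j.-homog -> (n + n <= j)%N ->
  exists w, inG (p - ell * w).
Proof.
move=> hp nj; have [c bcK] := invertible_mod.
have [|w [G _ _]] := reduce_mod_ell bcK hp; last by exists w.
by move=> q jq; exfalso; move: (size q) jq nj n_gt1; clear; move=> *; lia.
Qed.

(** * Generation of the syzygies of g1, g2, g3 *)

Section Generation.
Hypothesis sat0 : forall h, h \is (n - 2).-homog ->
  (exists N u v w, ell ^+ N * h = g1 * u + g2 * v + g3 * w) -> h = 0.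

Lemma colon_mod_ell k e : e \is (n + k).-homog ->
  exists2 q : S, q \is ((n + k).-1).-homog & inG (g3 * (e - ell * q)).
Proof.
elim: k e => [|k IH] e; first by rewrite addn0; apply: linkage.
rewrite addnS => /euler_split[f hf eE].
have [q Hq] : exists q : 'I_3 -> S, forall i,
    q i \is ((n + k).-1).-homog /\ inG (g3 * (f i - ell * q i)).
  exists (fun i => projT1 (cid2 (IH _ (hf i)))) => i.
  by case: (cid2 _).
exists (\sum_i 'X_i * q i).
  apply: rpred_sum => i _; have [hq _] := Hq i.
  by have := dhomogM (dhomogXi F i) hq; rewrite add1n prednK //; nlia.
rewrite eE mulr_sumr -sumrB mulr_sumr; apply: inG_sum => i.
have [_ Gq] := Hq i.
have -> : g3 * ('X_i * f i - ell * ('X_i * q i)) = g3 * (f i - ell * q i) * 'X_i by ring.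
exact: inGM.
Qed.

Lemma syzygy_generation k c1 c2 c3 : (n < k)%N ->
  c1 \is k.-homog -> c2 \is k.-homog -> c3 \is k.-homog ->
  g1 * c1 + g2 * c2 + g3 * c3 = 0 ->
  exists d1 d2 d3 : 'I_3 -> S,
    [/\ forall i, [/\ d1 i \is (k.-1).-homog, d2 i \is (k.-1).-homog &
                     d3 i \is (k.-1).-homog],
        forall i, g1 * d1 i + g2 * d2 i + g3 * d3 i = 0 &
        [/\ c1 = \sum_i 'X_i * d1 i, c2 = \sum_i 'X_i * d2 i &
            c3 = \sum_i 'X_i * d3 i]].
Proof.
case: k => // k nk hc1 hc2 hc3 E /=.
have nkE : k = (n + (k - n))%N by rewrite subnKC.
have [f hf c3E] := euler_split hc3.
have [q Hq] : exists q : 'I_3 -> S, forall i,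
    q i \is (k.-1).-homog /\ inG (g3 * (f i - ell * q i)).
  have H i : exists2 r : S, r \is (k.-1).-homog & inG (g3 * (f i - ell * r)).
    by have := hf i; rewrite nkE; apply: colon_mod_ell.
  by exists (fun i => projT1 (cid2 (H i))) => i; case: (cid2 _).
pose Q := \sum_i 'X_i * q i.
have hQ : Q \is k.-homog.
  apply: rpred_sum => i _; have [hq _] := Hq i.
  by have := dhomogM (dhomogXi F i) hq; rewrite add1n prednK //; nlia.
have GQ : inG (g3 * Q).
  apply: (@ell_saturated (n + k)); first exact: dhomogM.
  have -> : ell * (g3 * Q) = - (g1 * c1 + g2 * c2) - \sum_i g3 * (f i - ell * q i) * 'X_i.
    have -> : \sum_i g3 * (f i - ell * q i) * 'X_i = g3 * c3 - ell * (g3 * Q).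
      rewrite c3E /Q !mulr_sumr -sumrB; apply: eq_bigr => i _; ring.
    have /eqP := E; rewrite addrC addr_eq0 => /eqP ->; ring.
  apply: inGD; first by exists (- c1), (- c2); ring.
  rewrite -sumrN; apply: inG_sum => i; rewrite -mulrN; apply: inGM.
  by case: (Hq i).
have [el hel0 elE] := euler_split hel.
pose d3 i := f i - ell * q i + el i * Q.
have hd3 i : d3 i \is k.-homog.
  have [hq _] := Hq i; apply: dhomogD; last by have := dhomogM (hel0 i) hQ.
  apply: dhomogB => //; have := dhomogM hel hq; rewrite add1n prednK //; nlia.
have c3E' : c3 = \sum_i 'X_i * d3 i.
  have -> : \sum_i 'X_i * d3 i = c3 - ell * Q + (\sum_i 'X_i * el i) * Q.
    rewrite c3E [in ell * Q]/Q mulr_sumr mulr_suml -sumrB -big_split; apply: eq_bigr => i _ /=.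
    by rewrite /d3; ring.
  by rewrite -elE subrK.
have [uv Huv] : exists uv : 'I_3 -> S * S, forall i, [/\ (uv i).1 \is k.-homog,
    (uv i).2 \is k.-homog & g3 * d3 i = g1 * (uv i).1 + g2 * (uv i).2].
  have H i : exists uv : S * S, [/\ uv.1 \is k.-homog,
      uv.2 \is k.-homog & g3 * d3 i = g1 * uv.1 + g2 * uv.2].
    have Gd : inG (g3 * d3 i).
      rewrite /d3 mulrDr; apply: inGD; first by case: (Hq i).
      by rewrite mulrCA mulrC; apply: inGM.
    have [u [v]] := inG_homog (dhomogM hg3 (hd3 i)) Gd.
    by rewrite addKn => -[hu hv dE]; exists (u, v).
  by exists (fun i => projT1 (cid (H i))) => i; case: (cid _).
have hs (t : 'I_3 -> S) : (forall i, t i \is k.-homog) ->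
    \sum_i 'X_i * t i \is (k.+1).-homog.
  move=> ht; apply: rpred_sum => i _.
  by have := dhomogM (dhomogXi F i) (ht i); rewrite add1n.
(* What is left is a syzygy of [g1] and [g2] alone, hence Koszul with a multiplier [W] of positive
   degree, which splits along the variables as well. *)
have [|||W hW [W1 W2]] := @syzygy_g12 k.+1 (c1 + \sum_i 'X_i * (uv i).1)
    (c2 + \sum_i 'X_i * (uv i).2).
- by apply: dhomogD => //; apply: hs => i; case: (Huv i).
- by apply: dhomogD => //; apply: hs => i; case: (Huv i).
- have -> : g1 * (c1 + \sum_i 'X_i * (uv i).1) + g2 * (c2 + \sum_i 'X_i * (uv i).2)
    = g1 * c1 + g2 * c2 + g3 * c3; last by [].
  have -> : g3 * c3 = g1 * (\sum_i 'X_i * (uv i).1) + g2 * (\sum_i 'X_i * (uv i).2).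
    rewrite c3E' !mulr_sumr -big_split; apply: eq_bigr => i _ /=.
    by case: (Huv i) => _ _ dE; rewrite mulrCA dE; ring.
  ring.
rewrite subSn // in hW; have [w hw WE] := euler_split hW.
exists (fun i => g2 * w i - (uv i).1), (fun i => - (g1 * w i) - (uv i).2), d3.
have hgw g i : g \is n.-homog -> g * w i \is k.-homog.
  by move=> hg; have := dhomogM hg (hw i); rewrite subnKC.
split=> [i|i|].
- have [h1 h2 _] := Huv i; split=> //; apply: dhomogB; rewrite ?hgw //.
  by rewrite rpredN hgw.
- have [_ _ dE] := Huv i; rewrite dE; ring.
split=> //.
  have /eqP := W1; rewrite eq_sym -subr_eq => /eqP <-.
  by rewrite WE mulr_sumr -sumrB; apply: eq_bigr => i _; ring.
have /eqP := W2; rewrite eq_sym -subr_eq => /eqP <-.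
by rewrite WE mulr_sumr -sumrN -sumrB; apply: eq_bigr => i _; ring.
Qed.

End Generation.
End Linkage.
End LineCoordinates.

(** * A line on which the curve is squarefree *)

Section ExtendToPoly.
Variables (T : comNzRingType).
Implicit Types (s : {rmorphism T -> {poly T}}) (U V : {poly T}).

(** The endomorphism of T[t] that extends [s] and fixes t: evaluation at ['X] identifies the outer
    variable with that of the values of [s]. *)
Definition extend_poly s V : {poly T} := (map_poly s V).['X].

Lemma extend_polyC s c : extend_poly s c%:P = s c.
Proof. by rewrite /extend_poly map_polyC hornerC. Qed.

Lemma extend_polyX s : extend_poly s 'X = 'X.
Proof. by rewrite /extend_poly map_polyX hornerX. Qed.

Lemma extend_polyD s U V : extend_poly s (U + V) = extend_poly s U + extend_poly s V.
Proof. by rewrite /extend_poly rmorphD hornerD. Qed.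

Lemma extend_polyM s U V : extend_poly s (U * V) = extend_poly s U * extend_poly s V.
Proof. by rewrite /extend_poly rmorphM hornerM. Qed.

Lemma extend_polyK s s' V : (forall x, extend_poly s (s' x) = x%:P) ->
  extend_poly s (extend_poly s' V) = V.
Proof.
move=> ss'; elim/poly_ind: V => [|V c IH].
  by rewrite /extend_poly rmorph0 horner0 rmorph0 horner0.
by rewrite !(extend_polyD, extend_polyM, extend_polyX) IH extend_polyC ss'.
Qed.

End ExtendToPoly.

Section Shift.
Variables (n : nat) (F : numFieldType).
Local Notation S := {mpoly F[n]}.
Implicit Types (P Q : 'I_n -> F) (p : S) (V : {poly S}).

(** The substitution x + t P, or restriction to a line through the generic point; extended to S[t]
    it is an automorphism, inverse to the shift by - P. *)
Definition shift P : {rmorphism S -> {poly S}} :=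
  line (@mpolyC n F) (fun i => 'X_i : S) P.

Lemma shiftK P Q p : (forall i, P i = - Q i) ->
  extend_poly (shift P) (shift Q p) = p%:P.
Proof.
move=> PQ; elim/mpoly_ring_ind: p => [c|i|p q Hp Hq|p q Hp Hq].
- by rewrite lineC extend_polyC lineC.
- rewrite lineX extend_polyD extend_polyM !extend_polyC extend_polyX lineC lineX PQ.
  by rewrite /= mpolyCN polyCN mulNr addrNK.
- rewrite polyCD (rmorphD (shift Q)) extend_polyD; exact: congr2 Hp Hq.
- rewrite polyCM (rmorphM (shift Q)) extend_polyM; exact: congr2 Hp Hq.
Qed.

Lemma meval_shift P Q p : map_poly (meval Q) (shift P p) = line idfun Q P p.
Proof.
elim/mpoly_ring_ind: p => [c|i|p q Hp Hq|p q Hp Hq].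
- by rewrite !lineC map_polyC /= mevalC.
- by rewrite !lineX rmorphD rmorphM /= !map_polyC map_polyX /= mevalXU mevalC.
- rewrite (rmorphD (shift P)) (rmorphD (line idfun Q P)) rmorphD; exact: congr2 Hp Hq.
- rewrite (rmorphM (shift P)) (rmorphM (line idfun Q P)) rmorphM; exact: congr2 Hp Hq.
Qed.

End Shift.

Section GenericLine.
Variables (F : numFieldType).
Local Notation S := {mpoly F[3]}.
Variables (d : nat) (f : S).
Hypotheses (d_gt1 : (1 < d)%N) (hf : f \is d.-homog) (sf : squarefree f)
  (prf : forall g, component g f -> hprime g).

(** Write f = g q. Otherwise [g] divides [dird P g * q]: but not [q], as [f] is squarefree, and not
    [dird P g], which has smaller degree and is nonzero at [P] by Euler's formula. *)
Lemma component_dird P g : f.@[P] != 0 -> component g f -> ~ mdvd g (dird P f).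
Proof.
move=> fP [ig gf] gD; have f0 := squarefree_neq0 sf.
have [g0 ng _] := ig; have [e hg ed] := mdvd_homog f0 hf gf.
have [q hq fE] := mdvd_homogE hg hf gf.
have gP : g.@[P] != 0 by apply: contra_neq fP => gP; rewrite fE mevalM gP mul0r.
have e0 : (0 < e)%N.
  rewrite lt0n; apply: contra ng => /eqP e0; rewrite mpoly_unitE -mlead_deg //.
  by move/dhomogP: hg => /(_ _ (mlead_supp g0)) /= ->; rewrite e0.
have : mdvd g (dird P g * q).
  have -> : dird P g * q = dird P f + - (g * dird P q) by rewrite fE dirdM addrK.
  by apply: mdvdD => //; apply: mdvdN; exists (dird P q).
case/(prf (conj ig gf) (dird_homog P hg) hq) => [gg|[r qE]].
  have Dg0 : dird P g = 0 by apply: mdvd_lt_deg hg (dird_homog P hg) _ gg; rewrite prednK.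
  have := dird_meval P hg; rewrite Dg0 meval0 => /esym/eqP.
  by rewrite mulf_eq0 pnatr_eq0 (negPf gP) orbF => /eqP e0'; rewrite e0' in e0.
by case/negP: ng; apply: sf; exists r; rewrite fE qE mulrA.
Qed.

Lemma mdvd_dird P v : f.@[P] != 0 -> mdvd f (v * dird P f) -> mdvd f v.
Proof.
move=> fP fv; apply: mdvd_of_pihomog => j.
apply: (squarefree_mdvd hf sf prf (pihomogP [measure of mdeg] j v)) => g cg.
have hj : mdvd f (pihomog mdeg j v * dird P f).
  have := mdvd_pihomog (j + d.-1) hf fv; rewrite mulrC.
  by rewrite (pihomogM _ _ (dird_homog P hf)) ltnNge leq_addl addnK mulrC.
have := mdvd_trans cg.2 hj; case/(prf cg (pihomogP [measure of mdeg] j v) (dird_homog P hf)) => //.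
by move/(component_dird fP cg).
Qed.

Lemma size_shift P : f.@[P] != 0 -> size (shift P f) = d.+1.
Proof.
move=> fP; have [sG cG] := line_homog (@mpolyC 3 F) (fun i => 'X_i : S) P hf.
apply/eqP; rewrite eqn_leq sG ltnNge; apply: contra fP => sG'.
by move/eqP: cG; rewrite nth_default // eq_sym /= mpolyC_eq0.
Qed.

(** A zero resultant gives V G' = W G with V nonzero and shorter than G. Undoing the shift makes [G]
    and [G'] constant in t, so by [mdvd_dird] [f] divides each coefficient of the unshifted V;
    shifting back, [G] divides V. *)
Lemma shift_resultant P : f.@[P] != 0 ->
  resultant (shift P f) (shift P (dird P f)) != 0.
Proof.
move=> fP; apply/negP => /eqP r0.
set G := shift P f in r0 *; set G' := shift P _ in r0 *.
have sG : size G = d.+1 := size_shift fP.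
pose P' i := - P i.
have P'P i : P' i = - P i by [].
have PP' i : P i = - P' i by rewrite opprK.
have EG : extend_poly (shift P') G = f%:P := shiftK f P'P.
have EG' : extend_poly (shift P') G' = (dird P f)%:P := shiftK (dird P f) P'P.
have GE : shift P f = G by [].
clearbody G G'.
have G0 : G != 0 by rewrite -size_poly_gt0 sG.
have [V [W [V0 sV VW]]] : exists V W : {poly S}, [/\ V != 0, (size V < size G)%N & V * G' = W * G].
  have : (1 < size (gcdp G G'))%N by rewrite -resultant_eq0 r0.
  set D := gcdp G G' => sD.
  have /Pdiv.Idomain.dvdpP[[c1 u] /= c10 E1] := dvdp_gcdl G G'.
  have /Pdiv.Idomain.dvdpP[[c2 w] /= c20 E2] := dvdp_gcdr G G'.
  have cG0 : c1 *: G != 0 by rewrite scale_poly_eq0 negb_or c10.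
  have u0 : u != 0 by apply: contra_neq cG0 => u0; rewrite E1 u0 mul0r.
  have D0 : D != 0 by rewrite -size_poly_gt0 ltnW.
  exists (c2 *: u), (c1 *: w); split.
  - by rewrite scale_poly_eq0 negb_or c20.
  - rewrite size_scale // -(size_scale G c10) E1 size_mul //.
    by move: u0; rewrite -size_poly_gt0; move: (size u) (size D) sD; clear; move=> *; lia.
  - rewrite -scalerAl scalerAr E2 -scalerAl [in RHS]scalerAr E1; ring.
have E : extend_poly (shift P') V * (dird P f)%:P = extend_poly (shift P') W * f%:P.
  have := congr1 (extend_poly (shift P')) VW; rewrite 2!extend_polyM => E0.
  exact: etrans (congr1 ( *%R _) (esym EG')) (etrans E0 (congr1 ( *%R _) EG)).
have [H HE] : exists H : {poly S}, extend_poly (shift P') V = f%:P * H.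
  have Hk k : exists h, (extend_poly (shift P') V)`_k = f * h.
    apply: (mdvd_dird fP); exists (extend_poly (shift P') W)`_k.
    by rewrite -coefMC E coefMC mulrC.
  exists (\poly_(k < size (extend_poly (shift P') V)) projT1 (cid (Hk k))).
  apply/polyP => k; rewrite coefCM coef_poly; case: ltnP => kV.
    by case: (cid _).
  by rewrite mulr0 nth_default.
have VE : V = G * extend_poly (shift P) H.
  rewrite -[LHS](@extend_polyK _ (shift P) (shift P')) => [|x]; last exact: shiftK.
  apply: etrans (congr1 (extend_poly (shift P)) HE) _.
  by rewrite extend_polyM extend_polyC GE.
have H0 : extend_poly (shift P) H != 0 by apply: contra_neq V0 => H0; rewrite VE H0 mulr0.
move: sV; rewrite VE size_mul // ltnNge => /negP; apply.
move: H0; rewrite -size_poly_gt0; move: (size G) (size _); clear; move=> *; lia.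
Qed.

(** The resultant is a polynomial in the base point and lies in the ideal of the two shifts; at a
    [Q] where it does not vanish, this specializes to a Bezout relation. *)
Lemma generic_line : exists P Q, f.@[P] != 0 /\
  coprimep (line idfun Q P f) (line idfun Q P (dird P f)).
Proof.
have [P fP] := meval_neq0 (squarefree_neq0 sf).
have [Q rQ] := meval_neq0 (shift_resultant fP).
have sG := size_shift fP.
have [||[u v] /= _ E] := @resultant_in_ideal _ (shift P f) (shift P (dird P f)).
- by rewrite sG ltnS ltnW.
- have [_ c] := line_homog (@mpolyC 3 F) (fun i => 'X_i : S) P (dird_homog P hf).
  rewrite ltnNge; apply: contra fP => s1; move/eqP: c.
  rewrite nth_default; last by apply: leq_trans s1 _; rewrite -ltnS prednK // ltnW.
  rewrite eq_sym mpolyC_eq0 (dird_meval P hf) mulf_eq0 pnatr_eq0.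
  by case/orP => // /eqP d0; move: d_gt1; rewrite d0.
exists P, Q; split => //; apply/Bezout_coprimepP.
exists (map_poly (meval Q) u, map_poly (meval Q) v) => /=.
have := congr1 (map_poly (meval Q)) E; rewrite map_polyC rmorphD.
by rewrite (rmorphM _ u) (rmorphM _ v) /= !meval_shift => <-; rewrite polyC_eqp1.
Qed.
End GenericLine.

(** * Residues along the components *)

Section Indices.
Implicit Types (i j k : 'I_3).

Lemma I3_ind (P : 'I_3 -> Prop) j : P j -> P (j + 1) -> P (j + 1 + 1) -> forall i, P i.
Proof.
move=> P0 P1 P2 i.
have : [|| i == j, i == j + 1 | i == j + 1 + 1].
  by case: j i {P0 P1 P2} => [[|[|[|]]] //=] ? [[|[|[|]]] //=].
by case/or3P => /eqP ->.
Qed.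

Lemma I3_cycle j : j + 1 + 1 + 1 = j.
Proof. by apply: val_inj; case: j => [[|[|[|]]] //=]. Qed.

Lemma I3_neq j : (j == j + 1) = false /\ (j == j + 1 + 1) = false.
Proof. by case: j => [[|[|[|]]] //=]. Qed.

Lemma sum_I3 (V : nmodType) (E : 'I_3 -> V) j :
  \sum_i E i = E j + E (j + 1) + E (j + 1 + 1).
Proof.
have [n1 n2] := I3_neq j; have [n3 _] := I3_neq (j + 1).
rewrite (bigD1 j) //= (bigD1 (j + 1)) 1?eq_sym ?n1 //= (bigD1 (j + 1 + 1)) /=.
  rewrite big1 ?addr0 ?addrA //.
  by apply: (I3_ind (j := j)); rewrite eqxx ?andbF.
by rewrite ![j + 1 + 1 == _]eq_sym n2 n3.
Qed.

End Indices.

Section Cross.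
Variables (K : fieldType) (V : lmodType K).
Implicit Types (x : 'I_3 -> K) (v : 'I_3 -> V).

Definition cross x v k : V := x (k + 1) *: v (k + 1 + 1) - x (k + 1 + 1) *: v (k + 1).

(* Both [cross x v] and the functional [G] are orthogonal complements of the
   pair ([x], [v]), hence proportional. *)
Lemma cross_proportional x v (G : 'I_3 -> K) :
  \sum_j x j * G j = 0 -> \sum_j G j *: v j = 0 ->
  forall j k, G j *: cross x v k = G k *: cross x v j.
Proof.
move=> xG Gv.
have step j : G j *: cross x v (j + 1) = G (j + 1) *: cross x v j.
  rewrite /cross I3_cycle; move: xG Gv; rewrite !(sum_I3 _ j).
  move: (x j) (x (j + 1)) (x (j + 1 + 1)) (G j) (G (j + 1)) (G (j + 1 + 1)).
  move: (v j) (v (j + 1)) (v (j + 1 + 1)) => v0 v1 v2 x0 x1 x2 G0 G1 G2 xG Gv.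
  have E0 : G0 *: v0 = - (G1 *: v1) - G2 *: v2.
    by apply/eqP; rewrite -opprD -addr_eq0 addrA Gv.
  have E1 : G0 * x0 = - (G1 * x1) - G2 * x2.
    by apply/eqP; rewrite -opprD -addr_eq0 addrA -xG; apply/eqP; ring.
  rewrite !scalerBr !scalerA [G0 * x2]mulrC -(scalerA x2 G0 v0) E0 E1.
  rewrite scalerBr scalerN !scalerA scalerBl scaleNr opprB opprK.
  rewrite [x2 * G1]mulrC [x2 * G2]mulrC.
  by rewrite addrA subrK addrC.
move=> j; apply: (I3_ind (j := j)) => //.
have := step (j + 1 + 1); rewrite I3_cycle => <-.
done.
Qed.

End Cross.

Section Derivation.
Variables (F : numFieldType) (K : fieldType) (iota : {rmorphism F -> K}).
Variables (V : lmodType K) (D : K -> V).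
Hypothesis DD : derivation iota D.
Local Notation S := {mpoly F[3]}.

Lemma derivation_ev (ev : {rmorphism S -> K}) p :
  (forall c, ev c%:MP = iota c) -> D (ev p) = \sum_i ev p^`M(i) *: D (ev 'X_i).
Proof.
have [Da Dm Dc] := DD; move=> evC; elim/mpoly_ring_ind: p => [c|i|p q Hp Hq|p q Hp Hq].
- by rewrite evC Dc big1 // => i _; rewrite mderivC rmorph0 scale0r.
- rewrite (bigD1 i) //= mderivXi eqxx rmorph1 scale1r big1 ?addr0 // => j /negPf ji.
  by rewrite mderivXi eq_sym ji rmorph0 scale0r.
- rewrite rmorphD Da Hp Hq -big_split; apply: eq_bigr => i _.
  by rewrite mderivD rmorphD scalerDl.
rewrite rmorphM Dm Hp Hq !scaler_sumr -big_split; apply: eq_bigr => i _ /=.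
by rewrite mderivM rmorphD !rmorphM scalerDl !scalerA addrC mulrC.
Qed.

(** The terms in [D c] cancel by antisymmetry. The square is the 2 in the exponent [m.+2] of the
    condition [sat]. *)
Lemma cross_scaled (x : 'I_3 -> K) c k : c != 0 ->
  cross x (D \o x) k =
  c ^+ 2 *: cross (fun i => x i / c) (fun i => D (x i / c)) k.
Proof.
have [Da Dm Dc] := DD; move=> c0.
have Dx i : D (x i) = c *: D (x i / c) + (x i / c) *: D c.
  by rewrite -Dm mulrC divfK.
rewrite /cross /= !Dx; move: (k + 1) (k + 1 + 1) => i j.
rewrite !scalerDr opprD addrACA !scalerA.
have -> : x i * (x j / c) = x j * (x i / c) by ring.
rewrite subrr addr0 scalerN !scalerA.
by congr (_ *: _ - _ *: _); field.
Qed.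

End Derivation.

(** The quotient rule on chosen representatives; preservation of the kernel, applied to a
    cross-multiplied relation, shows that the choice does not matter. *)
Lemma derivation_of_fractions (F : numFieldType) (K : fieldType)
    (iota : {rmorphism F -> K}) (ev : {rmorphism {mpoly F[3]} -> K})
    (delta : {mpoly F[3]} -> {mpoly F[3]}) :
  (forall c, ev c%:MP = iota c) ->
  (forall a, exists p q, ev q != 0 /\ a = ev p / ev q) ->
  (forall c, delta c%:MP = 0) ->
  (forall p q, delta (p + q) = delta p + delta q) ->
  (forall p q, delta (p * q) = delta p * q + p * delta q) ->
  (forall p, ev p = 0 -> ev (delta p) = 0) ->
  exists D : K -> K^o, derivation iota D /\ forall p, D (ev p) = ev (delta p).
Proof.
move=> evC frac dC dD dM dker.
have fracT a : {pq : {mpoly F[3]} * {mpoly F[3]} | ev pq.2 != 0 /\ a = ev pq.1 / ev pq.2}.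
  by apply: cid; have [p [q H]] := frac a; exists (p, q).
pose num a := (sval (fracT a)).1; pose den a := (sval (fracT a)).2.
have den0 a : ev (den a) != 0 by rewrite /den; case: (fracT a) => ? [].
have fE a : a = ev (num a) / ev (den a) by rewrite /num /den; case: (fracT a) => ? [].
pose quo p q : K := (ev (delta p) * ev q - ev p * ev (delta q)) / ev q ^+ 2.
pose D a : K^o := quo (num a) (den a).
have DE p q : ev q != 0 -> D (ev p / ev q) = quo p q.
  move=> q0; rewrite /D /quo; set a := ev p / ev q; have b0 := den0 a.
  have E1 : ev (num a) = ev p * ev (den a) / ev q.
    by rewrite -[LHS](divfK b0) -fE /a; field.
  have : ev (delta (num a * q + (-1)%:MP * (p * den a))) = 0.
    apply: dker; rewrite rmorphD !rmorphM evC rmorphN1 E1; field; exact: q0.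
  rewrite dD !dM dC mul0r add0r !(rmorphD, rmorphM) evC rmorphN1 E1.
  move=> E2.
  have -> : ev (delta (num a)) = (ev (delta p) * ev (den a) + ev p * ev (delta (den a))
      - ev p * ev (den a) / ev q * ev (delta q)) / ev q.
    apply: (canRL (mulfK q0)); apply/eqP; rewrite -subr_eq0 -E2; apply/eqP; ring.
  by field; rewrite q0 b0.
exists D; split; last first.
  move=> p; have := DE p 1; rewrite rmorph1 divr1 => ->; last exact: oner_neq0.
  have d1 : delta 1 = 0 by rewrite -mpolyC1 dC.
  by rewrite /quo d1 rmorph1 rmorph0 mulr0 subr0 mulr1 expr1n divr1.
split=> [a b|a b|c].
- rewrite (fE a) (fE b); have a0 := den0 a; have b0 := den0 b.
  rewrite !DE //; move: (num a) (den a) (num b) (den b) a0 b0 => p q p' q' q0 q'0.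
  have -> : ev p / ev q + ev p' / ev q' = ev (p * q' + p' * q) / ev (q * q').
    by rewrite rmorphD !rmorphM; field; rewrite q0 q'0.
  rewrite DE ?rmorphM ?mulf_neq0 // /quo dD !dM !(rmorphD, rmorphM).
  by field; rewrite q0 q'0.
- rewrite (fE a) (fE b); have a0 := den0 a; have b0 := den0 b.
  rewrite !DE //; move: (num a) (den a) (num b) (den b) a0 b0 => p q p' q' q0 q'0.
  have -> : ev p / ev q * (ev p' / ev q') = ev (p * p') / ev (q * q').
    by rewrite !rmorphM; field; rewrite q0 q'0.
  rewrite DE ?rmorphM ?mulf_neq0 // /quo !dM !rmorphD !rmorphM.
  by rewrite /GRing.scale /=; field; rewrite q0 q'0.
- have := DE c%:MP 1; rewrite rmorph1 divr1 evC => ->; last exact: oner_neq0.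
  have d1 : delta 1 = 0 by rewrite -mpolyC1 dC.
  by rewrite /quo dC d1 rmorph0 mul0r mulr0 subr0 mul0r.
Qed.

(** * Function field and regular forms of one component *)

Section Forms.
Variables (F : numFieldType) (K : fieldType) (iota : {rmorphism F -> K}).
Local Notation S := {mpoly F[3]}.
Variables (xi : 'I_3 -> K) (g : S).
Hypothesis ff : function_field g iota xi.
Hypothesis ig : mirreducible g.
Variable (e : nat).
Hypothesis hg : g \is e.-homog.
Local Notation ev := (mmap iota xi).

Lemma ev_eq0 k p : p \is k.-homog -> ev p = 0 <-> mdvd g p.
Proof. exact: (proj1 ff). Qed.

Lemma function_field_hprime : hprime g.
Proof.
move=> k l p q hp hq /(ev_eq0 (dhomogM hp hq)) /eqP.
by rewrite rmorphM mulf_eq0 => /orP[] /eqP; [move/(ev_eq0 hp) | move/(ev_eq0 hq)]; [left|right].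
Qed.

Lemma ev_g : ev g = 0.
Proof. by apply/(ev_eq0 hg); exists 1; rewrite mulr1. Qed.

Lemma degree_gt0 : (0 < e)%N.
Proof.
have [g0 ng _] := ig; rewrite lt0n; apply: contra ng => /eqP e0.
rewrite mpoly_unitE -mlead_deg //.
by move/dhomogP: hg => /(_ _ (mlead_supp g0)) /= ->; rewrite e0.
Qed.

(** By degree, a partial derivative of [g] vanishing on the curve is 0; if all of them were, Euler's
    formula in characteristic 0 would give [g = 0]. *)
Lemma gradient_neq0 : exists k, ev g^`M(k) != 0.
Proof.
apply: contrapT => H; have [g0 _ _] := ig; move/negP: g0; apply.
have D0 k : g^`M(k) = 0.
  apply: mdvd_lt_deg hg (mderiv_homog k hg) _ _; first by rewrite prednK ?degree_gt0.
  apply/(ev_eq0 (mderiv_homog k hg)); apply: contrapT => /eqP gk; apply: H.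
  by exists k.
have := euler hg; rewrite big1 => [|k _]; last by rewrite D0 mulr0.
move/esym/eqP; rewrite -mul_mpolyC mulf_eq0 mpolyC_eq0 pnatr_eq0.
by have := degree_gt0; case: e.
Qed.

(** Otherwise [g] divides every variable, and differentiating ['X_i = g * u i] at the generic point
    writes the identity matrix as a product of a column and a row. *)
Lemma xi_neq0 : exists i, xi i != 0.
Proof.
apply: contrapT => H.
have [u Hu] : exists u : 'I_3 -> S, forall i, 'X_i = g * u i.
  have X i : mdvd g 'X_i.
    apply/(ev_eq0 (dhomogXi F i)); rewrite mmapX mmap1U.
    by apply: contrapT => /eqP xi0; apply: H; exists i.
  by exists (fun i => projT1 (cid (X i))) => i; case: (cid _).
have E i j : ev g^`M(j) * ev (u i) = (i == j)%:R.
  have := congr1 (fun p => ev p^`M(j)) (Hu i); rewrite mderivXi mderivM.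
  by rewrite rmorphD !rmorphM /= ev_g mul0r addr0 rmorph_nat => <-.
have := E 0 1; move/eqP; rewrite mulf_eq0 => /orP[] /eqP E0.
  by have := E 1 1; rewrite E0 mul0r => /eqP; rewrite eq_sym oner_eq0.
by have := E 0 0; rewrite E0 mulr0 => /eqP; rewrite eq_sym oner_eq0.
Qed.

Section Affine.
Variables (i : 'I_3).
Hypothesis xi0 : xi i != 0.
Local Notation et := (mmap iota (fun j => xi j / xi i)).

Lemma et_scale k p : p \is k.-homog -> ev p = xi i ^+ k * et p.
Proof.
move=> hp; move: k p hp; apply: dhomog_ind => [k|c|j|k p q Hp Hq|k l p q Hp Hq].
- by rewrite !rmorph0 mulr0.
- by rewrite !mmapC mul1r.
- by rewrite !mmapX !mmap1U expr1 mulrC divfK.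
- by rewrite !rmorphD /= Hp Hq mulrDr.
- by rewrite !rmorphM /= Hp Hq exprD mulrACA.
Qed.

Lemma et_eq0 k p : p \is k.-homog -> (et p == 0) = (ev p == 0).
Proof. by move=> hp; rewrite (et_scale hp) mulf_eq0 expf_eq0 (negPf xi0) andbF. Qed.

Lemma et_fraction a : exists p q, et q != 0 /\ a = et p / et q.
Proof.
have [k [p [q [hp hq q0 ->]]]] := proj2 ff a; exists p, q.
rewrite (et_eq0 hq); split=> //.
have q0' : et q != 0 by rewrite (et_eq0 hq).
by rewrite (et_scale hp) (et_scale hq) -mulf_div divff ?mul1r // expf_eq0 (negPf xi0) andbF.
Qed.

(* The Hamiltonian derivation of g in the affine chart x_i = 1: it kills g and
   x_i, and so descends to the function field. *)
Definition hamilton p : S :=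
  g^`M(i + 1) * p^`M(i + 1 + 1) - g^`M(i + 1 + 1) * p^`M(i + 1).

Lemma hamiltonD p q : hamilton (p + q) = hamilton p + hamilton q.
Proof. by rewrite /hamilton !mderivD; ring. Qed.

Lemma hamiltonM p q : hamilton (p * q) = hamilton p * q + p * hamilton q.
Proof. by rewrite /hamilton !mderivM; ring. Qed.

Lemma hamilton_sum (I : Type) (s : seq I) (E : I -> S) :
  hamilton (\sum_(j <- s) E j) = \sum_(j <- s) hamilton (E j).
Proof.
apply: (big_morph hamilton hamiltonD).
by rewrite /hamilton !mderiv0; ring.
Qed.

Lemma hamiltonC c : hamilton c%:MP = 0.
Proof. by rewrite /hamilton !mderivC; ring. Qed.

Lemma hamiltonXi : hamilton 'X_i = 0.
Proof.
by have [n1 n2] := I3_neq i; rewrite /hamilton !mderivXi n1 n2 !mulr0 subrr.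
Qed.

Lemma hamiltonXn m : hamilton ('X_i ^+ m) = 0.
Proof.
elim: m => [|m IH]; first by rewrite expr0 -mpolyC1 hamiltonC.
by rewrite exprS hamiltonM hamiltonXi IH mul0r mulr0 addr0.
Qed.

Lemma et_g : et g = 0.
Proof. by apply/eqP; rewrite (et_eq0 hg) ev_g. Qed.

Lemma et_Xi : et 'X_i = 1.
Proof. by rewrite mmapX mmap1U divff. Qed.

(** Homogenize [p] by ['X_i], which [et] sends to 1 and [hamilton] to 0; the result is a multiple of
    [g], which [hamilton] kills as well. *)
Lemma hamilton_ker p : et p = 0 -> et (hamilton p) = 0.
Proof.
move=> p0; pose N := msize p.
pose P : S := \sum_(k < N) 'X_i ^+ (N - k) * pihomog mdeg k p.
have hP : P \is N.-homog.
  apply: rpred_sum => k _; have kN := ltnW (ltn_ord k).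
  have := dhomogM (dhomogMn (N - k) (dhomogXi F i)) (pihomogP [measure of mdeg] k p).
  by rewrite mul1n subnK.
have etP : et P = et p.
  rewrite [in RHS](pihomog_sum p) !rmorph_sum; apply: eq_bigr => k _.
  by rewrite rmorphM rmorphXn /= et_Xi expr1n mul1r.
have [u Pu] : mdvd g P.
  by apply/(ev_eq0 hP); apply/eqP; rewrite -(et_eq0 hP) etP p0.
have hgg : hamilton g = 0 by rewrite /hamilton; ring.
have <- : et (hamilton P) = et (hamilton p).
  rewrite [in RHS](pihomog_sum p) !hamilton_sum !rmorph_sum; apply: eq_bigr => k _.
  rewrite hamiltonM hamiltonXn mul0r add0r.
  by rewrite rmorphM rmorphXn /= et_Xi expr1n mul1r.
by rewrite Pu hamiltonM hgg mul0r add0r rmorphM /= et_g mul0r.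
Qed.

(** In the chart, the cross product of the point with its derivative is minus the gradient of [g]:
    by construction at the two indices other than [i], by Euler's formula at [i]. *)
Lemma exists_derivation : exists D : K -> K^o, derivation iota D /\
  forall k, cross xi (D \o xi) k = 0 -> ev g^`M(k) = 0.
Proof.
have etC c : et c%:MP = iota c by rewrite mmapC.
have [D [DD DE]] := derivation_of_fractions etC et_fraction hamiltonC hamiltonD
  hamiltonM hamilton_ker.
exists D; split=> // k; rewrite (cross_scaled DD _ _ xi0).
have Dt j : D (xi j / xi i) = et (hamilton 'X_j) by rewrite -DE /= mmapX mmap1U.
have etX j : et 'X_j = xi j / xi i by rewrite mmapX mmap1U.
have eulert : \sum_j et 'X_j * et g^`M(j) = 0.
  rewrite (eq_bigr (fun j => et ('X_j * g^`M(j)))) => [|j _]; last by rewrite rmorphM.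
  by rewrite -rmorph_sum (euler hg) -mul_mpolyC rmorphM /= et_g mulr0.
suff -> : cross (fun j => xi j / xi i) (fun j => D (xi j / xi i)) k = - et g^`M(k).
  move/eqP; rewrite /GRing.scale /= mulf_eq0 expf_eq0 (negPf xi0) andbF /=.
  by rewrite oppr_eq0 (et_eq0 (mderiv_homog k hg)) => /eqP.
have [n1 n2] := I3_neq i; have [n3 _] := I3_neq (i + 1).
have D0 : D (xi i / xi i) = 0 by rewrite Dt hamiltonXi rmorph0.
have D1 : D (xi (i + 1) / xi i) = - et g^`M(i + 1 + 1).
  rewrite Dt /hamilton !mderivXi eqxx n3 mulr0 mulr1 sub0r rmorphN //.
have D2 : D (xi (i + 1 + 1) / xi i) = et g^`M(i + 1).
  by rewrite Dt /hamilton !mderivXi eqxx [_ == i + 1]eq_sym n3 mulr0 mulr1 subr0.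
have x1 : xi i / xi i = 1 by rewrite divff.
rewrite (sum_I3 _ i) et_Xi mul1r !etX in eulert.
rewrite /cross; move: k; apply: (I3_ind (j := i)).
- rewrite D1 D2 /GRing.scale /=; apply/eqP; rewrite -subr_eq0 -eulert; apply/eqP; ring.
- by rewrite I3_cycle D0 D2 x1 scaler0 sub0r scale1r.
- by rewrite !I3_cycle D0 D1 x1 scaler0 subr0 scale1r.
Qed.

End Affine.

Section Residue.
Variables (Om : lmodType K) (dd : K -> Om) (d : nat) (f h q : S).
Hypotheses (kah : kahler iota dd) (gen0 : genus iota xi dd 0).
Hypotheses (hf : f \is d.-homog) (fE : f = g * q) (q0 : ev q != 0).
Variables (l : nat).
Hypothesis hh : h \is l.-homog.
(* The exponent of [x_i] is tied to the degree [m] of the coefficients so that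
   the differential form [w] below has degree 0. *)
Hypothesis sat : forall i, exists m (a : 'I_3 -> S),
  (forall j, a j \is m.-homog) /\ 'X_i ^+ m.+2 * h = \sum_j a j * f^`M(j).

Lemma ev_partial k : ev f^`M(k) = ev g^`M(k) * ev q.
Proof. by rewrite fE mderivM rmorphD !rmorphM /= ev_g mul0r addr0. Qed.

Lemma adjoint_form_eq0 : mdvd g h.
Proof.
have [DO _] := kah; have [Da Dm Dc] := DO.
have [k gk] := gradient_neq0.
have fk : ev f^`M(k) != 0 by rewrite ev_partial mulf_neq0.
have evX j : ev 'X_j = xi j by rewrite mmapX mmap1U.
have evf : ev f = 0 by rewrite fE rmorphM /= ev_g mul0r.
have prop : forall j, ev f^`M(j) *: cross xi (dd \o xi) k =
    ev f^`M(k) *: cross xi (dd \o xi) j.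
  move=> j; apply: (cross_proportional (G := fun j => ev f^`M(j))).
    rewrite (eq_bigr (fun j => ev ('X_j * f^`M(j)))) => [|j' _]; last by rewrite rmorphM /= evX.
    by rewrite -rmorph_sum (euler hf) -mul_mpolyC rmorphM /= evf mulr0.
  have := derivation_ev DO (ev := ev) f (fun c => mmapC _ _ _).
  rewrite /= evf => E; have dd0 : dd 0 = 0 by have := Dc 0; rewrite rmorph0.
  rewrite -[RHS]dd0 E; apply: eq_bigr => j' _.
  by rewrite /= mmapX mmap1U.
pose w := (ev h / ev f^`M(k)) *: cross xi (dd \o xi) k.
have reg : regular_form iota xi dd w.
  move=> i xi0; have [m [a [ha aE]]] := sat i.
  pose et := mmap iota (fun j => xi j / xi i).
  (* By [prop], the partial derivative that multiplies [a j] cancels the denominator and turns the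
     [k]-th cross product into the [j]-th. *)
  have wE : w = \sum_j et (a j) *: cross (fun j => xi j / xi i) (fun j => dd (xi j / xi i)) j.
    have xm : xi i ^+ m.+2 != 0 by rewrite expf_eq0 (negPf xi0) andbF.
    have hE : ev h = xi i ^- m.+2 * \sum_j ev (a j) * ev f^`M(j).
      rewrite -(eq_bigr _ (fun j _ => rmorphM ev (a j) _)) -rmorph_sum -aE.
      by rewrite rmorphM rmorphXn /= evX mulKf.
    rewrite /w hE mulr_sumr mulr_suml scaler_suml; apply: eq_bigr => j _.
    rewrite -!mulrA [ev f^`M(j) / _]mulrC !mulrA -scalerA prop scalerA.
    rewrite (cross_scaled DO _ _ xi0) scalerA (et_scale xi0 (ha j)).
    rewrite !exprS; congr (_ *: _); field.
    by rewrite fk xi0 expf_eq0 (negPf xi0) andbF.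
  pose pr (uv : S * S) := (et uv.1, et uv.2).
  pose s1 := [seq (a j * 'X_(j + 1), 'X_(j + 1 + 1) : S) | j <- index_enum 'I_3].
  pose s2 := [seq (- (a j * 'X_(j + 1 + 1)), 'X_(j + 1) : S) | j <- index_enum 'I_3].
  exists [seq pr uv | uv <- s1 ++ s2]; split.
    have int p : normal_chart iota xi i (et p).
      exists ('X - p%:P); first exact: monicXsubC.
      by rewrite /et map_polyXsubC root_XsubC.
    by move=> u /mapP[uv _ ->]; split; apply: int.
  rewrite big_map big_cat /= /s1 /s2 !big_map wE -big_split.
  apply: eq_bigr => j _; rewrite /= /cross scalerBr !scalerA /et.
  by rewrite rmorphN !rmorphM /= !mmapX !mmap1U scaleNr.
have w0 : w = 0.
  by have [b [_ /(_ w reg)[c [-> _]]]] := gen0; rewrite big_ord0.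
have [i xi0] := xi_neq0.
(* [D] factors through [dd] and its cross product has a nonzero [k]-th component, so [w = 0] forces
   [ev h = 0]. *)
have [D [DD Dcross]] := exists_derivation xi0.
have [_ univ] := kah; have [phi phiE _] := univ _ _ DD.
have phiw : phi w = (ev h / ev f^`M(k)) *: cross xi (D \o xi) k.
  by rewrite /w linearZ /= /cross linearB !linearZ /= !phiE.
apply/(ev_eq0 hh); apply/eqP; move: phiw; rewrite w0 linear0 => /esym/eqP.
rewrite /GRing.scale /= mulf_eq0 => /orP[|/eqP/Dcross/eqP]; last by rewrite (negPf gk).
by rewrite mulf_eq0 invr_eq0 (negPf fk) orbF.
Qed.

End Residue.
End Forms.

(** * Degrees of the generators *)

Section Frame.
Variables (F : numFieldType).
Local Notation S := {mpoly F[3]}.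
Implicit Types (P Q : 'I_3 -> F).

Lemma frame_exists P Q : (exists j, P j != 0) -> (forall c, ~ Q =1 (fun j => c * P j)) ->
  exists M : 'M[F]_3, [/\ M \in unitmx, forall j, M 0 j = P j &
    forall j, M (0 + 1) j = Q j].
Proof.
move=> [j0 Pj0] indep.
(* The minors of (P, Q): where [N i] is nonzero, the [i]-th unit vector completes the basis. *)
pose N i := P (i + 1) * Q (i + 1 + 1) - P (i + 1 + 1) * Q (i + 1).
have [i Ni] : exists i, N i != 0.
  apply: contrapT => H.
  have {}H i : P (i + 1) * Q (i + 1 + 1) = P (i + 1 + 1) * Q (i + 1).
    by apply/eqP; rewrite -subr_eq0; apply: contrapT => /negP Ni; apply: H; exists i.
  apply: (indep (Q j0 / P j0)).
  have {}H k : P j0 * Q k = P k * Q j0.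
    move: k; apply: (I3_ind (j := j0)) => //.
      by have := H (j0 + 1 + 1); rewrite I3_cycle.
    by have := H (j0 + 1); rewrite !I3_cycle => ->.
  by move=> k; apply: (mulfI Pj0); rewrite H; field.
have [[n1 n2] [n3 _]] := (I3_neq 0, I3_neq (0 + 1)).
have [[n1' n2'] n3'] : ((0 + 1 == 0 :> 'I_3) = false /\ (0 + 1 + 1 == 0 :> 'I_3) = false) /\
  (0 + 1 + 1 == 0 + 1 :> 'I_3) = false by rewrite eq_sym n1 eq_sym n2 eq_sym n3.

pose M := \matrix_(r < 3, j < 3) (if r == 0 then P j else if r == 0 + 1 then Q j
  else (j == i)%:R).
exists M; split=> [|j|j]; last 2 first.
- by rewrite mxE eqxx.
- by rewrite mxE n1' eqxx.
rewrite -row_free_unit; apply: inj_row_free => v vM.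
have E j : v 0 0 * P j + v 0 (0 + 1) * Q j + v 0 (0 + 1 + 1) * (j == i)%:R = 0.
  have := congr1 (fun A : 'rV_3 => A 0 j) vM; rewrite !mxE (sum_I3 _ 0) => <-.
  by rewrite !mxE eqxx n1' n2' eqxx n3'.
have [m1 m2] := I3_neq i.
have E1 := E (i + 1); rewrite eq_sym m1 mulr0 addr0 in E1.
have E2 := E (i + 1 + 1); rewrite eq_sym m2 mulr0 addr0 in E2.
have v0 : v 0 0 = 0.
  apply: (mulIf Ni); rewrite mul0r /N.
  have -> : v 0 0 * (P (i + 1) * Q (i + 1 + 1) - P (i + 1 + 1) * Q (i + 1)) =
    (v 0 0 * P (i + 1) + v 0 (0 + 1) * Q (i + 1)) * Q (i + 1 + 1)
    - (v 0 0 * P (i + 1 + 1) + v 0 (0 + 1) * Q (i + 1 + 1)) * Q (i + 1) by ring.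
  by rewrite E1 E2 !mul0r subrr.
have v1 : v 0 (0 + 1) = 0.
  apply: (mulIf Ni); rewrite mul0r /N.
  have -> : v 0 (0 + 1) * (P (i + 1) * Q (i + 1 + 1) - P (i + 1 + 1) * Q (i + 1)) =
    (v 0 0 * P (i + 1 + 1) + v 0 (0 + 1) * Q (i + 1 + 1)) * P (i + 1)
    - (v 0 0 * P (i + 1) + v 0 (0 + 1) * Q (i + 1)) * P (i + 1 + 1) by ring.
  by rewrite E1 E2 !mul0r subrr.
have v2 : v 0 (0 + 1 + 1) = 0 by have := E i; rewrite v0 v1 !mul0r !add0r eqxx mulr1.
by apply/rowP => j; rewrite [RHS]mxE; move: j; apply: (I3_ind (j := 0)).
Qed.

Lemma meval0_homog k (p : S) : p \is (k.+1).-homog -> p.@[fun=> 0] = 0.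
Proof.
case/euler_split => f _ ->; rewrite rmorph_sum big1 // => i _.
by rewrite rmorphM /= mevalXU mul0r.
Qed.

End Frame.

(** * Syzygies of a curve with rational components *)

Section RationalComponents.
Variables (F : numFieldType) (d : nat) (f : {mpoly F[3]}).
Local Notation S := {mpoly F[3]}.
Hypotheses (d_ge3 : (3 <= d)%N) (hf : f \is d.-homog) (sf : squarefree f).
Hypothesis rat : forall g : S, component g f -> rational_curve g.

Lemma rational_component_hprime g : component g f -> hprime g.
Proof.
by move=> cg; have [K [iota [xi [Om [dd [ff _ _]]]]]] := rat cg; apply: function_field_hprime ff.
Qed.

Lemma adjoint_eq0 h : h \is (d - 3).-homog ->
  (forall i, exists m (a : 'I_3 -> S),
    (forall j, a j \is m.-homog) /\ 'X_i ^+ m.+2 * h = \sum_j a j * f^`M(j)) ->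
  h = 0.
Proof.
move=> hh sat; have f0 := squarefree_neq0 sf.
apply: (mdvd_lt_deg hf hh); first nlia.
apply: (squarefree_mdvd hf sf rational_component_hprime hh) => g cg.
have [ig gf] := cg; have [e hg _] := mdvd_homog f0 hf gf.
have [q hq fE] := mdvd_homogE hg hf gf.
have [K [iota [xi [Om [dd [ff kah gen]]]]]] := rat cg.
apply: (adjoint_form_eq0 ff ig hg kah gen hf fE _ hh sat).
apply/eqP => /(ev_eq0 ff hq) [r qE]; have [_ ng _] := ig.
by case/negP: ng; apply: sf; exists r; rewrite fE qE mulrA.
Qed.

Definition grad : 'cV[S]_3 := \col_j f^`M(j).

Lemma AR_grad (r : 'rV[S]_3) : AR f r <-> r *m grad = 0.
Proof.
have E : (r *m grad) 0 0 = \sum_(j < 3) r 0 j * f^`M(j).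
  by rewrite mxE; apply: eq_bigr => j _; rewrite mxE.
split=> [H|H]; last by rewrite /AR -E H mxE.
by apply/matrixP => i j; rewrite !ord1 E [RHS]mxE.
Qed.

Lemma AR_generation k (r : 'rV[S]_3) : (d <= k)%N ->
  (forall j, r 0 j \is k.-homog) -> AR f r ->
  exists s : 'I_3 -> 'rV[S]_3,
    [/\ forall i j, s i 0 j \is (k.-1).-homog, forall i, AR f (s i) &
        r = \sum_i 'X_i *: s i].
Proof.
move=> dk hr /AR_grad rf.
have d_gt1 : (1 < d)%N by nlia.
have [P [Q [fP cop]]] := generic_line d_gt1 hf sf rational_component_hprime.
pose rho := line idfun Q P.
have rhoC c : rho c%:MP = c%:P by rewrite /rho lineC.
have rhoX i : rho 'X_i = (Q i)%:P + (P i)%:P * 'X by rewrite /rho lineX.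
have [M [Mu M0 M1]] : exists M : 'M[F]_3, [/\ M \in unitmx, forall j, M 0 j = P j &
    forall j, M (0 + 1) j = Q j].
  apply: frame_exists.
    apply: contrapT => H; move/eqP: fP; apply.
    have -> : f.@[P] = f.@[fun=> 0].
      apply: meval_eq => j; apply: contrapT => /eqP Pj; apply: H; by exists j.
    by apply: (@meval0_homog F d.-1); rewrite prednK // ltnW.
  (* If [Q] were [c] times [P], the line would pass through the origin at the parameter [- c], where
     [f] and its derivative along [P] both vanish. *)
  move=> c Qc.
  have root0 k' (p : S) : p \is (k'.+1).-homog -> root (rho p) (- c).
    move=> hp; rewrite rootE /rho line_horner -(meval0_homog hp); apply/eqP/meval_eq => j.
    by rewrite Qc; ring.
  have r1 : root (rho f) (- c) by apply: (root0 d.-1); rewrite prednK // ltnW.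
  have r2 : root (rho (dird P f)) (- c).
    by apply: (root0 d.-2); have := dird_homog P hf; rewrite -(@prednK d.-1) //; nlia.
  have := coprimep_root cop r1; rewrite -rootE => /negP; exact.
pose M' := invmx M.
have MM' : M *m M' = 1%:M by rewrite mulmxV.
have M'M : M' *m M = 1%:M by rewrite mulVmx.
(* The coordinates dual to the rows of [M]; on the line [Q + t P] they are t, 1 and 0. *)
pose co k0 : S := \sum_j M' j k0 *: 'X_j.
have hco k0 : co k0 \is 1.-homog.
  by apply: rpred_sum => j _; apply/dhomogZ/dhomogXi.
have rho_co k0 : rho (co k0) = (k0 == 0 + 1)%:R + (k0 == 0)%:R * 'X.
  rewrite /co rmorph_sum.
  have -> : \sum_j rho (M' j k0 *: 'X_j) =
     ((M *m M') (0 + 1) k0)%:P + ((M *m M') 0 k0)%:P * 'X.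
    rewrite !mxE !rmorph_sum mulr_suml -big_split; apply: eq_bigr => j _ /=.
    by rewrite -mul_mpolyC rmorphM rhoC rhoX M0 M1 !polyCM; ring.
  by rewrite MM' !mxE ![_ == k0]eq_sym !polyC_natr.
have [[n1 n2] [n3 _]] := (I3_neq 0, I3_neq (0 + 1)).
have [[n1' n2'] n3'] : ((0 + 1 == 0 :> 'I_3) = false /\ (0 + 1 + 1 == 0 :> 'I_3) = false) /\
  (0 + 1 + 1 == 0 + 1 :> 'I_3) = false by rewrite eq_sym n1 eq_sym n2 eq_sym n3.

pose alpha := co 0; pose beta := co (0 + 1); pose ell := co (0 + 1 + 1).
have rho_al : rho alpha = 'X by rewrite /alpha rho_co n1 eqxx add0r mul1r.
have rho_be : rho beta = 1.
  by rewrite /beta rho_co eqxx n1' mul0r addr0.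
have rho_el : rho ell = 0.
  by rewrite /ell rho_co n2' n3' mul0r addr0.
have Xco i : 'X_i = \sum_k0 M k0 i *: co k0.
  have -> : \sum_k0 M k0 i *: co k0 = \sum_j (M' *m M) j i *: 'X_j.
    rewrite /co; under eq_bigr do rewrite scaler_sumr.
    rewrite exchange_big; apply: eq_bigr => j _ /=; rewrite mxE scaler_suml.
    by apply: eq_bigr => k0 _; rewrite scalerA mulrC.
  rewrite M'M (bigD1 i) //= mxE eqxx scale1r big1 ?addr0 // => j /negPf ji.
  by rewrite mxE ji scale0r.
have span i : exists x y z, 'X_i = x *: alpha + y *: beta + z *: ell.
  by exists (M 0 i), (M (0 + 1) i), (M (0 + 1 + 1) i); rewrite Xco (sum_I3 _ 0).
have ell0 : ell != 0.
  apply/eqP => e0; have : (M *m M') (0 + 1 + 1) (0 + 1 + 1) = 0.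
    have := congr1 (meval (fun j => M (0 + 1 + 1) j)) e0.
    rewrite /ell /co rmorph_sum /= meval0 => <-; rewrite mxE.
    by apply: eq_bigr => j _; rewrite mevalZ mevalXU mulrC.
  by rewrite MM' mxE eqxx => /eqP; rewrite oner_eq0.
pose Mp : 'M[S]_3 := map_mx (@mpolyC 3 F) M.
pose Mp' : 'M[S]_3 := map_mx (@mpolyC 3 F) M'.
have MpMp' : Mp' *m Mp = 1%:M by rewrite /Mp /Mp' -map_mxM M'M map_mx1.
pose g k0 : S := (Mp *m grad) k0 0.
have gE k0 : g k0 = dird (M k0) f.
  by rewrite /g mxE; apply: eq_bigr => j _; rewrite !mxE mul_mpolyC.
have hg k0 : g k0 \is (d.-1).-homog by rewrite gE; apply: dird_homog.
have hgn : (d.-1).+1 = d by rewrite prednK // ltnW.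
have n_gt1 : (1 < d.-1)%N by nlia.
have grho : rho (g 0) = rho (dird P f).
  rewrite gE; congr (rho _); apply: eq_bigr => j _; by rewrite M0.
have size_rg1 : size (rho (g 0)) = d.-1.+1.
  rewrite grho; have [sG cG] := line_homog idfun Q P (dird_homog P hf).
  apply/eqP; rewrite eqn_leq sG ltnNge; apply/negP => sG'.
  move/eqP: cG; rewrite nth_default // eq_sym (dird_meval P hf) mulf_eq0.
  by rewrite (negPf fP) orbF pnatr_eq0; move: d_gt1; case: (d).
have cop' : coprimep (rho (g 0)) (rho (g (0 + 1))).
  (* Euler's formula at the point [t P + Q]; it trades [rho f] for the derivative along [Q] in the
     coprimality. *)
  have E : 'X * rho (g 0) + rho (g (0 + 1)) = d%:R *: rho f.
    have <- : rho (d%:R *: f) = d%:R *: rho f.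
      by rewrite -mul_mpolyC rmorphM rhoC mul_polyC.
    rewrite -(euler hf) !gE /dird !rmorph_sum mulr_sumr -big_split.
    apply: eq_bigr => j _ /=; rewrite -!mul_mpolyC !rmorphM !rhoC rhoX M0 M1; ring.
  rewrite -(coprimep_addl_mul 'X) E coprimepZr ?pnatr_eq0; last by move: d_gt1; case: (d).
  by rewrite coprimep_sym grho.
have sat0 h : h \is (d.-1 - 2).-homog ->
    (exists N u v w, ell ^+ N * h = g 0 * u + g (0 + 1) * v + g (0 + 1 + 1) * w) -> h = 0.
  move=> hh [N [u [v [w E]]]]; have hh' : h \is (d - 3).-homog.
    by have -> : (d - 3 = d.-1 - 2)%N by nlia.
  (* With n = d - 1, degree 2 n puts ['X_i ^+ t2] in the ideal of [g 0], [g (0 + 1)] and [ell]; its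
     [N]-th power then lies in the ideal of the first two and [ell ^+ N]. *)
  apply: adjoint_eq0 => // i; pose t2 := (d.-1 + d.-1)%N; pose m := (t2 * N)%N.
  have hX k' : ('X_i : S) ^+ k' \is k'.-homog.
    by have := dhomogMn k' (dhomogXi F i); rewrite mul1n.
  have [x [A [B E1]]] : exists x, inG (g 0) (g (0 + 1)) ('X_i ^+ t2 - ell * x).
    exact: (large_degree (hco _) (hco _) (hco _) rhoC rho_al rho_be rho_el span n_gt1
      (hg _) (hg _) size_rg1 cop' (hX t2) (leqnn _)).
  have [y [A' [B' E2]]] : exists y A' B', 'X_i ^+ m = g 0 * A' + g (0 + 1) * B' + ell ^+ N * y.
    rewrite /m; elim: (N) => [|N' [y [A' [B' IH]]]].
      by exists 1, 0, 0; rewrite muln0 !expr0; ring.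
    rewrite mulnS exprD IH -['X_i ^+ t2](subrK (ell * x)) E1.
    exists (x * y), ((g 0 * A + g (0 + 1) * B + ell * x) * A' + A * (ell ^+ N' * y)),
      ((g 0 * A + g (0 + 1) * B + ell * x) * B' + B * (ell ^+ N' * y)).
    by rewrite exprS; ring.
  have [b bE] : exists b : 'I_3 -> S, 'X_i ^+ m * h = \sum_j b j * f^`M(j).
    pose t (k0 : 'I_3) : S := if k0 == 0 then A' * h + y * u else if k0 == 0 + 1 then B' * h + y * v
      else y * w.
    exists (fun j => \sum_k0 t k0 * (M k0 j)%:MP).
    have -> : \sum_j (\sum_k0 t k0 * (M k0 j)%:MP) * f^`M(j) = \sum_k0 t k0 * g k0.
      under eq_bigr do rewrite mulr_suml; rewrite exchange_big; apply: eq_bigr => k0 _.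
      rewrite gE /dird mulr_sumr; apply: eq_bigr => j _.
      by rewrite -mul_mpolyC mulrA.
    rewrite (sum_I3 _ 0) /t eqxx n1' n2' eqxx n3' E2.
    have -> : (g 0 * A' + g (0 + 1) * B' + ell ^+ N * y) * h =
      (g 0 * A' + g (0 + 1) * B') * h + y * (ell ^+ N * h) by ring.
    by rewrite E; ring.
  (* The extra ['X_i ^+ 2] balances the degrees: (m + 2) + (d - 3) = m + (d - 1). *)
  exists m, (fun j => pihomog mdeg m ('X_i ^+ 2 * b j)); split=> [j|].
    exact: pihomogP.
  have hm := dhomogM (hX m.+2) hh'; rewrite -[LHS](pihomog_dE hm).
  have -> : 'X_i ^+ m.+2 * h = \sum_j f^`M(j) * ('X_i ^+ 2 * b j).
    rewrite -(addn2 m) exprD mulrAC bE mulrC mulr_sumr; apply: eq_bigr => j _; ring.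
  rewrite linear_sum; apply: eq_bigr => j _ /=.
  rewrite (pihomogM _ _ (mderiv_homog j hf)) mulrC.
  have -> : (m.+2 + (d - 3) < d.-1)%N = false by apply/negbTE; rewrite -leqNgt; nlia.
  by have -> : (m.+2 + (d - 3) - d.-1 = m)%N by nlia.
pose c : 'rV[S]_3 := r *m Mp'.
have hc k0 : c 0 k0 \is k.-homog.
  rewrite mxE; apply: rpred_sum => j _; rewrite !mxE mulrC mul_mpolyC.
  exact: dhomogZ.
have cr : c *m Mp = r by rewrite /c -mulmxA MpMp' mulmx1.
have Eg (v : 'rV[S]_3) : (v *m Mp *m grad) 0 0 =
    g 0 * v 0 0 + g (0 + 1) * v 0 (0 + 1) + g (0 + 1 + 1) * v 0 (0 + 1 + 1).
  by rewrite -mulmxA mxE (sum_I3 _ 0) ![v _ _ * _]mulrC.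
have dk' : (d.-1 < k)%N by rewrite hgn.
have csyz : g 0 * c 0 0 + g (0 + 1) * c 0 (0 + 1) + g (0 + 1 + 1) * c 0 (0 + 1 + 1) = 0.
  by rewrite -Eg cr rf mxE.
have [d1 [d2 [d3 [hd sd [c1 c2 c3]]]]] := syzygy_generation (hco _) (hco _) (hco _)
    rhoC rho_al rho_be rho_el span n_gt1 (hg _) (hg _) (hg _) size_rg1 cop' ell0 sat0
    dk' (hc 0) (hc (0 + 1)) (hc (0 + 1 + 1)) csyz.
pose ee i : 'rV[S]_3 := \row_k0 (if k0 == 0 then d1 i else if k0 == 0 + 1 then d2 i else d3 i).
have ee0 i : ee i 0 0 = d1 i by rewrite mxE eqxx.
have ee1 i : ee i 0 (0 + 1) = d2 i by rewrite mxE n1' eqxx.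
have ee2 i : ee i 0 (0 + 1 + 1) = d3 i.
  by rewrite mxE n2' n3'.
have hee i k0 : ee i 0 k0 \is (k.-1).-homog.
  have [h1 h2 h3] := hd i; move: k0; apply: (I3_ind (j := 0)); by rewrite ?ee0 ?ee1 ?ee2.
exists (fun i => ee i *m Mp); split=> [i j|i|].
- rewrite mxE; apply: rpred_sum => k0 _; rewrite [Mp _ _]mxE mulrC mul_mpolyC.
  exact/dhomogZ/hee.
- apply/AR_grad/matrixP => x y; rewrite !ord1 Eg [RHS]mxE ee0 ee1 ee2; exact: sd.
rewrite -cr; have -> : c = \sum_i 'X_i *: ee i.
  apply/rowP => k0; rewrite summxE.
  have -> : \sum_i ('X_i *: ee i) 0 k0 = \sum_i 'X_i * ee i 0 k0.
    by apply: eq_bigr => i _; rewrite mxE.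
  move: k0; apply: (I3_ind (j := 0)).
  - by rewrite c1; apply: eq_bigr => i _; rewrite ee0.
  - by rewrite c2; apply: eq_bigr => i _; rewrite ee1.
  - by rewrite c3; apply: eq_bigr => i _; rewrite ee2.
rewrite mulmx_suml; apply: eq_bigr => i _; by rewrite scalemxAl.
Qed.

End RationalComponents.

(** Graded Nakayama: a generator of degree at least [d] lies in the ideal of the variables times
    [AR f], hence is redundant. *)
Lemma generators_degree (F : numFieldType) (d : nat) (f : {mpoly F[3]}) (ds : seq nat) :
  (3 <= d)%N -> f \is d.-homog -> squarefree f -> exponents f ds ->
  (forall g : {mpoly F[3]}, component g f -> rational_curve g) ->
  (last 0%N ds <= d - 1)%N.
Proof.
move=> d3 hf sf [sds [G [hG gen min]]] rat; rewrite leqNgt; apply/negP => lt_d.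
have ds0 : (0 < size ds)%N by case: (ds) lt_d.
pose k : 'I_(size ds) := Ordinal (ltac:(by rewrite ltn_predL) : ((size ds).-1 < size ds)%N).
have dsk : nth 0%N ds k = last 0%N ds by rewrite nth_last.
set D := last 0%N ds in lt_d dsk.
have ARk : AR f (row k G).
  by apply/gen; exists (delta_mx 0 k); rewrite rowE.
have dD : (d <= D)%N by move: lt_d d3; clear; move=> *; lia.
have [|s [hs ARs sE]] := AR_generation d3 hf sf rat dD _ ARk.
  by move=> j; rewrite mxE -dsk.
have [c cE] : exists c : 'I_3 -> 'rV_(size ds), forall i, s i = c i *m G.
  have H i : exists c, s i = c *m G by apply/gen.
  by exists (fun i => projT1 (cid (H i))) => i; case: (cid _).
(* Only this homogeneous part of a coefficient contributes to a row of degree [D.-1]; generator [k],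
   of degree [D], gets coefficient 0. *)
pose cc i : 'rV_(size ds) := \row_l (if (nth 0%N ds l <= D.-1)%N
  then pihomog mdeg (D.-1 - nth 0%N ds l) (c i 0 l) else 0).
have ccE i : s i = cc i *m G.
  apply/rowP => j; rewrite -(pihomog_dE (hs i j)) cE !mxE linear_sum.
  apply: eq_bigr => l _ /=; rewrite mulrC (pihomogM _ _ (hG l j)) mxE ltnNge.
  by case: leqP => _; rewrite ?mul0r // mulrC.
have cck i : cc i 0 k = 0.
  by rewrite mxE dsk; case: leqP => //; move: lt_d; clear; move=> *; lia.
pose e : 'rV_(size ds) := \sum_i 'X_i *: cc i.
have rE : row k G = e *m G.
  rewrite sE /e mulmx_suml; apply: eq_bigr => i _.
  by rewrite ccE scalemxAl.
have ek : e 0 k = 0.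
  by rewrite summxE big1 // => i _; rewrite mxE cck mulr0.
apply: (min k) => r; split=> [/gen [v ->]|[v ->]]; last first.
  apply/gen; exists (v *m row' k 1%:M).
  by rewrite -mulmxA !row'Esub mul_rowsub_mx mul1mx.
(* Replace generator [k] by its expression [e] in the other ones. *)
pose w := v + v 0 k *: (e - delta_mx 0 k).
have wG : v *m G = w *m G.
  by rewrite mulmxDl -scalemxAl mulmxBl -rE -rowE subrr scaler0 addr0.
have wk : w 0 k = 0.
  by rewrite !mxE ek !eqxx sub0r mulrN1 subrr.
exists (col' k w); rewrite wG; apply/rowP => j; rewrite !mxE (bigD1_ord k) //= wk mul0r add0r.
by apply: eq_bigr => l _; rewrite !mxE.
Qed.

Local Open Scope complex_scope.

Theorem corollary5p2 (R : realType) (d : nat) (f : {mpoly R[i][3]})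
    (ds : seq nat) :
  (3 <= d)%N ->
  f \is d.-homog ->
  squarefree f ->
  exponents f ds ->
  (forall g : {mpoly R[i][3]}, component g f -> rational_curve g) ->
  (last 0%N ds <= d - 1)%N.
Proof. exact: generators_degree. Qed.
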